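(* Every provably recursive function of $\mathbf{A}(\mathrm{PR})$ is provable with basic terms; that is, if $f:\mathbb{N}^n\to\mathbb{N}$ is a provably recursive function of $\mathbf{A}(\mathrm{PR})$, then there is a strongly coherent full program $(P,\mathsf{f})$ computing $f$ such that $\mathbf{A}(P)\vdash_{b}\forall\vec{x}\,\exists y\;\mathsf{f}(\vec{x})=y$.
   Context: For a set $P$ of first-order equations, let $\mathcal{L}$ be the language of $P$ together with a constant $\mathsf{0}$ and a unary function symbol $\mathsf{S}$. The theory $\mathbf{A}(P)$ is the first-order theory with equality in $\mathcal{L}$ whose axioms are: the universal closures of the equations in $P$; the separation axioms $\forall x\;\mathsf{S}(x)\neq\mathsf{0}$ and $\forall x,y\;(\mathsf{S}(x)=\mathsf{S}(y)\to x=y)$; and induction $A[\mathsf{0}]\to\forall x\,(A[x]\to A[\mathsf{S}(x)])\to\forall x\,A[x]$ for every formula $A$ of $\mathcal{L}$. Derivations use classical natural deduction with the usual quantifier rules plus the equality rules (from $A[t]$ and $t=s$ infer $A[s]$; $t=t$ is an axiom). $\mathrm{PR}$ is the set of standard defining equations of all primitive recursive functions; $\mathbf{A}(\mathrm{PR})$ is Peano Arithmetic with all primitive recursive function symbols. A function $f$ is provably recursive in $\mathbf{A}(\mathrm{PR})$ if $\mathbf{A}(\mathrm{PR})\vdash\forall\vec{x}\,\exists y\;T(e,\vec{x},y)$ for the code $e$ of some deterministic Turing machine computing $f$, where $T(e,\vec x,y)$ is the arithmetic formula expressing that the machine with code $e$ terminates on inputs $\vec x$ with computation trace coded by $y$.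 A program is a pair $(P,\mathsf{f})$ of a set of equations $P$ and a function symbol $\mathsf f$ occurring in $P$. $P\vdash_{=}E$ means the equation $E$ is derivable from $P$ in equational logic (rules: members of $P$; $t=t$; substitution of an arbitrary term for a variable; from $s[t]=r[t]$ and $t=t'$ infer $s[t']=r[t']$). The relation computed by $(P,\mathsf f)$ is $\{(\vec n,m)\mid P\vdash_{=}\mathsf f(\vec{\bar n})=\bar m\}$, where $\bar n$ is the numeral $\mathsf S^n(\mathsf 0)$. $P$ is strongly coherent if $\mathbf{A}(P)$ is consistent. $P$ is full if whenever $P$ contains a function symbol corresponding to a primitive recursive function, it also contains all the $\mathrm{PR}$ defining equations for that function. A term is basic if built from $\mathsf 0$, $\mathsf S$ and variables only. $T\vdash_b A$ means $A$ has a classical natural deduction derivation in $T$ in which every term used in a $\forall$-elimination or $\exists$-introduction is basic. *)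

(* Defs.v *)
From mathcomp Require Import all_boot.
From Stdlib Require List.

Set Implicit Arguments.
Unset Strict Implicit.
Unset Printing Implicit Defensive.

Definition vnil {T : Type} : 'I_0 -> T :=
  fun i => match notF (ltn_ord i) with end.

Definition vcons {T : Type} {n : nat} (a : T) (v : 'I_n -> T) : 'I_n.+1 -> T :=
  fun i => if unlift ord0 i is Some j then v j else a.

Notation "[@ x ; .. ; y ]" := (vcons x .. (vcons y vnil) ..)
  (at level 0, format "[@  x ;  .. ;  y ]").

(* One function symbol for each primitive recursive definition.  [PRec g h]
   recurses on its first argument; its step function [h] takes the predecessor,
   the previous value and the parameters, in this order. *)
Inductive prim : nat -> Type :=
| PZero n : prim n
| PSucc : prim 1
| PProj n (i : 'I_n) : prim n
| PComp n m (h : prim m) (g : 'I_m -> prim n) : prim n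
| PRec n (g : prim n) (h : prim n.+2) : prim n.+1.

(* The primitive recursive symbols, and infinitely many others in each arity.
   The constant 0 and the successor S are term constructors. *)
Inductive funsym (n : nat) : Type :=
| Pr (p : prim n)
| Usr (k : nat).

Inductive term : Type :=
| Var (i : nat)
| Zero
| Succ (t : term)
| App n (f : funsym n) (ts : 'I_n -> term).

Definition equation : Type := (term * term)%type.

(* de Bruijn indices: [All] and [Ex] bind the variable of index 0. *)
Inductive form : Type :=
| Bot
| Eqn (t s : term)
| Imp (A B : form)
| And (A B : form)
| Or (A B : form)
| All (A : form)
| Ex (A : form).

Definition Neg (A : form) : form := Imp A Bot.

Fixpoint num (n : nat) : term := if n is m.+1 then Succ (num m) else Zero.

Definition vars n : 'I_n -> term := fun i => Var i.

Fixpoint basic (t : term) : bool :=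
  match t with
  | Var _ => true
  | Zero => true
  | Succ t => basic t
  | App _ _ _ => false
  end.

Fixpoint tsubst (sigma : nat -> term) (t : term) : term :=
  match t with
  | Var i => sigma i
  | Zero => Zero
  | Succ t => Succ (tsubst sigma t)
  | App _ f ts => App f (fun i => tsubst sigma (ts i))
  end.

Definition subst_up (sigma : nat -> term) : nat -> term :=
  fun i => if i is j.+1 then tsubst (fun k => Var k.+1) (sigma j) else Var 0.

Fixpoint fsubst (sigma : nat -> term) (A : form) : form :=
  match A with
  | Bot => Bot
  | Eqn t s => Eqn (tsubst sigma t) (tsubst sigma s)
  | Imp A B => Imp (fsubst sigma A) (fsubst sigma B)
  | And A B => And (fsubst sigma A) (fsubst sigma B)
  | Or A B => Or (fsubst sigma A) (fsubst sigma B)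
  | All A => All (fsubst (subst_up sigma) A)
  | Ex A => Ex (fsubst (subst_up sigma) A)
  end.

Definition shift : form -> form := fsubst (fun i => Var i.+1).

Definition inst (t : term) : form -> form :=
  fsubst (fun i => if i is j.+1 then Var j else t).

(* A[S(x)], where x, of index 0, stays free. *)
Definition inst_succ : form -> form :=
  fsubst (fun i => if i is j.+1 then Var j.+1 else Succ (Var 0)).

Fixpoint tbound (t : term) : nat :=
  match t with
  | Var i => i.+1
  | Zero => 0
  | Succ t => tbound t
  | App _ _ ts => \max_i tbound (ts i)
  end.

(* Quantifies over all variables up to the largest one that occurs, hence
   vacuously over the missing ones. *)
Definition closure (E : equation) : form :=
  iter (maxn (tbound E.1) (tbound E.2)) All (Eqn E.1 E.2).

Definition language : Type := forall n, funsym n -> Prop.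

Fixpoint occurs n (f : funsym n) (t : term) : Prop :=
  match t with
  | Var _ => False
  | Zero => False
  | Succ t => occurs f t
  | App m g ts => existT funsym n f = existT funsym m g \/ exists i, occurs f (ts i)
  end.

Definition lang (P : equation -> Prop) : language :=
  fun n f => exists2 E, P E & occurs f E.1 \/ occurs f E.2.

Definition tin (L : language) (t : term) : Prop :=
  forall n (f : funsym n), occurs f t -> L n f.

Fixpoint fin (L : language) (A : form) : Prop :=
  match A with
  | Bot => True
  | Eqn t s => tin L t /\ tin L s
  | Imp A B => fin L A /\ fin L B
  | And A B => fin L A /\ fin L B
  | Or A B => fin L A /\ fin L B
  | All A => fin L A
  | Ex A => fin L A
  end.

(* Derivations in the language [L] from the axioms [Ax], where the terms used
   in forall-elimination and exists-introduction satisfy [B].  The language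
   conditions are imposed where a rule introduces new material, so that every
   formula of a derivation from an empty context is in [L]. *)
Inductive nd (L : language) (Ax : form -> Prop) (B : term -> Prop) :
    seq form -> form -> Prop :=
| NdAx G A : Ax A -> nd L Ax B G A
| NdHyp G A : List.In A G -> nd L Ax B G A
| NdRaa G A : fin L A -> nd L Ax B (Neg A :: G) Bot -> nd L Ax B G A
| NdImpI G A C : fin L A -> nd L Ax B (A :: G) C -> nd L Ax B G (Imp A C)
| NdImpE G A C : nd L Ax B G (Imp A C) -> nd L Ax B G A -> nd L Ax B G C
| NdAndI G A C : nd L Ax B G A -> nd L Ax B G C -> nd L Ax B G (And A C)
| NdAndE1 G A C : nd L Ax B G (And A C) -> nd L Ax B G A
| NdAndE2 G A C : nd L Ax B G (And A C) -> nd L Ax B G C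
| NdOrI1 G A C : fin L C -> nd L Ax B G A -> nd L Ax B G (Or A C)
| NdOrI2 G A C : fin L A -> nd L Ax B G C -> nd L Ax B G (Or A C)
| NdOrE G A C D :
    nd L Ax B G (Or A C) -> nd L Ax B (A :: G) D -> nd L Ax B (C :: G) D ->
    nd L Ax B G D
| NdAllI G A : nd L Ax B (map shift G) A -> nd L Ax B G (All A)
| NdAllE G A t : tin L t -> B t -> nd L Ax B G (All A) -> nd L Ax B G (inst t A)
| NdExI G A t : tin L t -> B t -> nd L Ax B G (inst t A) -> nd L Ax B G (Ex A)
| NdExE G A C :
    nd L Ax B G (Ex A) -> nd L Ax B (A :: map shift G) (shift C) -> nd L Ax B G C
| NdRefl G t : tin L t -> nd L Ax B G (Eqn t t)
| NdSubst G A t s :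
    nd L Ax B G (inst t A) -> nd L Ax B G (Eqn t s) -> nd L Ax B G (inst s A).

Inductive thA (P : equation -> Prop) : form -> Prop :=
| ThEqn E : P E -> thA P (closure E)
| ThSuccNeq0 : thA P (All (Neg (Eqn (Succ (Var 0)) Zero)))
| ThSuccInj :
    thA P (All (All (Imp (Eqn (Succ (Var 1)) (Succ (Var 0)))
                         (Eqn (Var 1) (Var 0)))))
| ThInd A : fin (lang P) A ->
    thA P (Imp (inst Zero A) (Imp (All (Imp A (inst_succ A))) (All A))).

Definition provable (P : equation -> Prop) (A : form) : Prop :=
  nd (lang P) (thA P) (fun=> True) [::] A.

Definition provable_basic (P : equation -> Prop) (A : form) : Prop :=
  nd (lang P) (thA P) basic [::] A.

Definition defeqs n (p : prim n) : seq equation :=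
  match p in prim n return seq equation with
  | PZero n => [:: (App (Pr (PZero n)) (@vars n), Zero)]
  | PSucc => [:: (App (Pr PSucc) (@vars 1), Succ (Var 0))]
  | PProj n i => [:: (App (Pr (PProj i)) (@vars n), Var i)]
  | PComp n m h g =>
      [:: (App (Pr (PComp h g)) (@vars n),
           App (Pr h) (fun j => App (Pr (g j)) (@vars n)))]
  | PRec n g h =>
      let x_ := fun i : 'I_n => Var i.+1 in
      [:: (App (Pr (PRec g h)) (vcons Zero x_), App (Pr g) x_);
          (App (Pr (PRec g h)) (vcons (Succ (Var 0)) x_),
           App (Pr h)
             (vcons (Var 0) (vcons (App (Pr (PRec g h)) (vcons (Var 0) x_)) x_)))]
  end.

Definition PR (E : equation) : Prop := exists n (p : prim n), List.In E (defeqs p).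

Definition put (x : nat) (r : term) : term -> term :=
  tsubst (fun i => if i == x then r else Var i).

Inductive eqprv (P : equation -> Prop) : equation -> Prop :=
| EqMem E : P E -> eqprv P E
| EqRefl t : eqprv P (t, t)
| EqSubst x r t s : eqprv P (t, s) -> eqprv P (put x r t, put x r s)
| EqRepl x s r t t' :
    eqprv P (put x t s, put x t r) -> eqprv P (t, t') ->
    eqprv P (put x t' s, put x t' r).

Definition program_computes n (P : equation -> Prop) (g : funsym n)
    (f : n.-tuple nat -> nat) : Prop :=
  forall (x : n.-tuple nat) (m : nat),
    eqprv P (App g (fun i => num (tnth x i)), num m) <-> m = f x.

Definition strongly_coherent (P : equation -> Prop) : Prop := ~ provable P Bot.

Definition full (P : equation -> Prop) : Prop :=
  forall n (p : prim n), lang P (Pr p) ->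
  forall E, List.In E (defeqs p) -> P E.

(* [(q, a, q', b, rgt)]: in state [q] scanning [a], write [b], move right or
   left, and enter state [q'].  States and symbols are natural numbers; 0 is
   both the initial state and the blank. *)
Definition instr : Type := (nat * nat * nat * nat * bool)%type.

(* [(q, l, r)]: the scanned cell is the first one of [r], the cells of [l] are
   those to its left, nearest first, and all other cells are blank. *)
Definition config : Type := (nat * seq nat * seq nat)%type.

Definition machine : Type := seq instr.

Definition applicable (i : instr) (c : config) : bool :=
  let: (q, a, _, _, _) := i in
  let: (q0, _, r) := c in (q == q0) && (a == head 0 r).

Definition act (i : instr) (c : config) : config :=
  let: (_, _, q', b, rgt) := i in
  let: (_, l, r) := c in
  if rgt then (q', b :: l, behead r)
  else (q', behead l, head 0 l :: b :: behead r).

Definition tm_step (M : machine) : rel config :=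
  fun c c' => has (fun i => applicable i c && (c' == act i c)) M.

Definition tm_halted (M : machine) (c : config) : bool :=
  ~~ has (fun i => applicable i c) M.

Definition deterministic (M : machine) : Prop :=
  forall i i' c, i \in M -> i' \in M -> applicable i c -> applicable i' c -> i = i'.

(* Start in state 0 on the first cell; a number x is written as x + 1 strokes
   followed by a blank. *)
Definition tm_init (x : seq nat) : config :=
  (0, [::], foldr (fun k r => nseq k.+1 1 ++ 0 :: r) [::] x).

(* The result is the total number of strokes on the tape. *)
Definition tm_output (c : config) : nat :=
  let: (_, l, r) := c in count_mem 1 l + count_mem 1 r.

(* [c :: cs] is a terminating computation. *)
Definition tm_run (M : machine) (c : config) (cs : seq config) : bool :=
  path (tm_step M) c cs && tm_halted M (last c cs).

Definition tm_computes (M : machine) n (f : n.-tuple nat -> nat) : Prop :=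
  forall x : n.-tuple nat, exists2 cs : seq config,
    tm_run M (tm_init x) cs & tm_output (last (tm_init x) cs) = f x.

Definition code_instr (i : instr) : nat :=
  let: (q, a, q', b, rgt) := i in CodeSeq.code [:: q; a; q'; b; rgt : nat].

Definition code_config (c : config) : nat :=
  let: (q, l, r) := c in CodeSeq.code [:: q; CodeSeq.code l; CodeSeq.code r].

Definition code_machine (M : machine) : nat := CodeSeq.code (map code_instr M).

Definition code_trace (cs : seq config) : nat := CodeSeq.code (map code_config cs).

Notation arg n i := (@PProj n (@Ordinal n i isT)) (only parsing).

Fixpoint pconst n (k : nat) : prim n :=
  if k is k'.+1 then PComp PSucc [@ pconst n k'] else PZero n.

Definition padd : prim 2 := PRec (arg 1 0) (PComp PSucc [@ arg 3 1]).
Definition pmul : prim 2 := PRec (PZero 1) (PComp padd [@ arg 3 1; arg 3 2]).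
Definition ppred : prim 1 := PRec (PZero 0) (arg 2 0).
Definition psub : prim 2 :=
  PComp (PRec (arg 1 0) (PComp ppred [@ arg 3 1])) [@ arg 2 1; arg 2 0].

(* Truth values: 1 is true, 0 is false; as a condition, any nonzero number
   counts as true. *)
Definition pnot : prim 1 := PRec (pconst 0 1) (PZero 2).
Definition ptrue : prim 1 := PComp pnot [@ pnot].
Definition pif : prim 3 := PRec (arg 2 1) (arg 4 2).
Definition peq : prim 2 :=
  PComp pnot [@ PComp padd [@ psub; PComp psub [@ arg 2 1; arg 2 0]]].

(* Quantification over i < k, for the first argument k; the first argument of
   [body] is i. *)
Definition pall n (body : prim n.+1) : prim n.+1 :=
  PRec (pconst n 1)
    (PComp pmul
       [@ PComp body
            (vcons (arg n.+2 0) (fun j => PProj (lift ord0 (lift ord0 j))));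
          arg n.+2 1]).
Definition pex n (body : prim n.+1) : prim n.+1 :=
  PComp pnot [@ pall (PComp pnot [@ body])].

(* The operations on sequences coded by [CodeSeq.code], for which the empty
   sequence is 0 and cons(a, s) = 2^a * (2s + 1). *)
Definition ppow2 : prim 1 :=
  PRec (pconst 0 1) (PComp padd [@ arg 2 1; arg 2 1]).
Definition podd : prim 1 := PRec (PZero 0) (PComp pnot [@ arg 2 1]).
Definition phalf : prim 1 :=
  PRec (PZero 0) (PComp padd [@ PComp podd [@ arg 2 0]; arg 2 1]).
Definition pcons : prim 2 :=
  PComp pmul
    [@ PComp ppow2 [@ arg 2 0];
       PComp PSucc [@ PComp padd [@ arg 2 1; arg 2 1]]].

(* pstrip (i, c): c halved i times, or as long as it is even. *)
Definition pstrip : prim 2 :=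
  PRec (arg 1 0)
    (PComp pif
       [@ PComp podd [@ arg 3 1]; arg 3 1; PComp phalf [@ arg 3 1]]).
Definition pbehead : prim 1 :=
  PComp phalf [@ PComp pstrip [@ arg 1 0; arg 1 0]].
(* The head is the number of i < c such that c halved i times is still even;
   the head of the empty sequence is 0. *)
Definition phead : prim 1 :=
  PComp
    (PRec (PZero 1)
       (PComp padd
          [@ PComp pnot [@ PComp podd [@ PComp pstrip [@ arg 3 0; arg 3 2]]];
             arg 3 1]))
    [@ arg 1 0; arg 1 0].
Definition pdrop : prim 2 := PRec (arg 1 0) (PComp pbehead [@ arg 3 1]).
Definition pnth : prim 2 := PComp phead [@ pdrop].

Definition field n (i : nat) (s : prim n) : prim n := PComp pnth [@ pconst n i; s].

(* Arguments: instruction, configuration. *)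
Definition papplicable : prim 2 :=
  let i := arg 2 0 in let c := arg 2 1 in
  PComp pmul
    [@ PComp peq [@ field 0 i; field 0 c];
       PComp peq [@ field 1 i; PComp phead [@ field 2 c]]].

Definition pact : prim 2 :=
  let i := arg 2 0 in let c := arg 2 1 in
  let q' := field 2 i in let b := field 3 i in
  let l := field 1 c in let r := field 2 c in
  let hd s := PComp phead [@ s] in
  let tl s := PComp pbehead [@ s] in
  let cons a s := PComp pcons [@ a; s] in
  let mk q l r := cons q (cons l (cons r (PZero 2))) in
  PComp pif
    [@ field 4 i;
       mk q' (cons b l) (tl r);
       mk q' (tl l) (cons (hd l) (cons b (tl r)))].

(* Arguments: machine, configuration, configuration. *)
Definition pstep : prim 3 :=
  let body : prim 4 :=
    let i := arg 4 0 in let e := arg 4 1 in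
    let c := arg 4 2 in let c' := arg 4 3 in
    let ins := PComp pnth [@ i; e] in
    PComp pmul
      [@ PComp ptrue [@ PComp pdrop [@ i; e]];
         PComp pmul
           [@ PComp papplicable [@ ins; c];
              PComp peq [@ c'; PComp pact [@ ins; c]]]] in
  PComp (pex body) [@ arg 3 0; arg 3 0; arg 3 1; arg 3 2].

(* Arguments: machine, configuration. *)
Definition phalted : prim 2 :=
  let body : prim 3 :=
    let i := arg 3 0 in let e := arg 3 1 in let c := arg 3 2 in
    PComp pnot
      [@ PComp pmul
           [@ PComp ptrue [@ PComp pdrop [@ i; e]];
              PComp papplicable [@ PComp pnth [@ i; e]; c]]] in
  PComp (pall body) [@ arg 2 0; arg 2 0; arg 2 1].

(* Arguments: i, machine, trace.  If the trace has an i-th configuration, then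
   the next one, if any, is a successor of it; otherwise, it is halted. *)
Definition plink : prim 3 :=
  let i := arg 3 0 in let e := arg 3 1 in let y := arg 3 2 in
  let d := PComp pdrop [@ i; y] in
  let hd s := PComp phead [@ s] in
  let tl s := PComp pbehead [@ s] in
  PComp pif
    [@ d;
       PComp pif
         [@ tl d;
            PComp pstep [@ e; hd d; hd (tl d)];
            PComp phalted [@ e; hd d]];
       pconst 3 1].

(* pstrokes (k, r): k + 1 strokes and a blank before r. *)
Definition pstrokes : prim 2 :=
  PRec
    (PComp pcons [@ pconst 1 1; PComp pcons [@ PZero 1; arg 1 0]])
    (PComp pcons [@ pconst 3 1; arg 3 1]).

Definition pinit n : prim n :=
  let r :=
    foldr (fun i r => PComp pstrokes [@ PProj i; r]) (PZero n) (enum 'I_n) in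
  let cons a s := PComp pcons [@ a; s] in
  cons (PZero n) (cons (PZero n) (cons r (PZero n))).

(* Kleene's T predicate.  Arguments: machine, trace, inputs. *)
Definition pT n : prim n.+2 :=
  let e := arg n.+2 0 in let y := arg n.+2 1 in
  let xs := fun j : 'I_n => PProj (lift ord0 (lift ord0 j)) in
  PComp pmul
    [@ PComp ptrue [@ y];
       PComp pmul
         [@ PComp peq [@ PComp phead [@ y]; PComp (pinit n) xs];
            PComp (pall plink) [@ y; e; y]]].

Definition formT n (e : term) (x : 'I_n -> term) (y : term) : form :=
  Eqn (App (Pr (pT n)) (vcons e (vcons y x))) (num 1).

(* forall x_1 ... x_n exists y, A; the variables x_1, ..., x_n have the indices
   1, ..., n in the scope of the existential quantifier. *)
Definition total_sentence n (A : ('I_n -> term) -> term -> form) : form :=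
  iter n All (Ex (A (fun i => Var i.+1) (Var 0))).

Definition provably_recursive n (f : n.-tuple nat -> nat) : Prop :=
  exists M : machine,
    [/\ deterministic M, tm_computes M f
      & provable PR (total_sentence (@formT n (num (code_machine M))))].

(* Main.v *)
Require Import Defs.
From mathcomp Require Import all_boot zify.
From Stdlib Require Import FunctionalExtensionality Classical.

Set Implicit Arguments.
Unset Strict Implicit.
Unset Printing Implicit Defensive.

(* A derivation of A(PR) becomes one with basic terms because every term t over
   the primitive recursive symbols is provably total with basic terms, i.e.
   [exists y, t = y]: to use t in a quantifier rule, take such a y in its place
   and rewrite it to t afterwards.

   The program for f adds to PR two fresh symbols f, k and the equations
     k(T(e,x,y), y, x) = f(x)   and   k(S(z), y, x) = U(y),
   where U(y) is the number of strokes in the last configuration of the trace y.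
   From T(e,x,y) = 1 they give f(x) = U(y), using instances at basic terms only,
   and U(y) is total.  They hold in the standard model if k(z,y,x) is U(y) for
   z <> 0 and f(x) for z = 0, since a trace of a deterministic machine is unique
   and so U(y) = f(x) whenever T(e,x,y) holds.  Hence A(P) is consistent and the
   program derives no wrong value; it derives the right ones because the standard
   model also satisfies the sentence [forall x, exists y, T(e,x,y)]. *)

(** * Vectors as functions on ordinals *)

Lemma vcons0 T n (a : T) (v : 'I_n -> T) : vcons a v ord0 = a.
Proof. by rewrite /vcons unlift_none. Qed.

Lemma vconsS T n (a : T) (v : 'I_n -> T) j : vcons a v (lift ord0 j) = v j.
Proof. by rewrite /vcons liftK. Qed.

Lemma forall_vcons T n (Q : T -> Prop) a (v : 'I_n -> T) :
  Q a -> (forall j, Q (v j)) -> forall i, Q (vcons a v i).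
Proof.
by move=> Qa Qv i; case: (unliftP ord0 i) => [j|] ->; rewrite ?vcons0 ?vconsS.
Qed.

Lemma vcons_eta T n (v : 'I_n.+1 -> T) :
  v = vcons (v ord0) (fun j => v (lift ord0 j)).
Proof.
apply: functional_extensionality => i.
by case: (unliftP ord0 i) => [j|] ->; rewrite ?vcons0 ?vconsS.
Qed.

Lemma map_vcons T U (F : T -> U) n a (v : 'I_n -> T) :
  (fun i => F (vcons a v i)) = vcons (F a) (fun i => F (v i)).
Proof.
rewrite [LHS]vcons_eta vcons0; congr vcons.
by apply: functional_extensionality => j; rewrite vconsS.
Qed.

Lemma map_vnil T U (F : T -> U) : (fun i => F (vnil i)) = vnil.
Proof. by apply: functional_extensionality => -[]. Qed.

(** * Substitution *)

Lemma tsubst_ext s r t :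
  (forall i, i < tbound t -> s i = r i) -> tsubst s t = tsubst r t.
Proof.
elim: t => [i||t IH|n f ts IH] //= e; first exact: e.
  by rewrite IH.
congr App; apply: functional_extensionality => i; apply: IH => j lt_j.
by apply/e/(leq_trans lt_j); apply: (@leq_bigmax _ (fun i => tbound (ts i))).
Qed.

Lemma tsubst_id t : tsubst Var t = t.
Proof.
elim: t => [i||t IH|n f ts IH] //=; first by rewrite IH.
by congr App; apply: functional_extensionality.
Qed.

Lemma tsubst_comp s r t :
  tsubst s (tsubst r t) = tsubst (fun i => tsubst s (r i)) t.
Proof.
elim: t => [i||t IH|n f ts IH] //=; first by rewrite IH.
by congr App; apply: functional_extensionality.
Qed.

Lemma tsubst_num s k : tsubst s (num k) = num k.
Proof. by elim: k => //= k ->. Qed.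

Lemma subst_up_comp s r :
  (fun i => tsubst (subst_up s) (subst_up r i)) =
  subst_up (fun i => tsubst s (r i)).
Proof. by apply: functional_extensionality => -[|i] //=; rewrite !tsubst_comp. Qed.

Lemma subst_up_id : subst_up Var = Var.
Proof. by apply: functional_extensionality => -[]. Qed.

Lemma fsubst_id A : fsubst Var A = A.
Proof.
by elim: A => [|t u|A IA B IB|A IA B IB|A IA B IB|A IA|A IA] //=;
  rewrite ?tsubst_id ?subst_up_id ?IA ?IB.
Qed.

Lemma fsubst_comp s r A :
  fsubst s (fsubst r A) = fsubst (fun i => tsubst s (r i)) A.
Proof.
elim: A s r => [|t u|A IA B IB|A IA B IB|A IA B IB|A IA|A IA] s r //=;
  by rewrite ?tsubst_comp ?IA ?IB ?subst_up_comp.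
Qed.

Lemma shift_inst t A :
  shift (inst t A) =
  inst (tsubst (fun i => Var i.+1) t) (fsubst (subst_up (fun i => Var i.+1)) A).
Proof.
rewrite /shift /inst !fsubst_comp; congr fsubst.
by apply: functional_extensionality => -[|i].
Qed.

(** * Terms and formulas in a language *)

Lemma tin_var L i : tin L (Var i). Proof. by move=> n f []. Qed.

Lemma tin_zero L : tin L Zero. Proof. by move=> n f []. Qed.

Lemma tin_vars L n i : tin L (@vars n i). Proof. by move=> m f []. Qed.

Lemma tin_succ L t : tin L t -> tin L (Succ t).
Proof. by []. Qed.

#[local] Hint Resolve tin_var tin_vars tin_zero tin_succ : core.

Lemma tin_num L k : tin L (num k). Proof. by elim: k. Qed.

Lemma tin_app (L : language) n (f : funsym n) ts :
  L n f -> (forall i, tin L (ts i)) -> tin L (App f ts).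
Proof.
move=> Lf tsL m g /= [eq_gf|[i]]; last exact: tsL.
change (L (projT1 (existT funsym m g)) (projT2 (existT funsym m g))).
by rewrite eq_gf.
Qed.

Lemma tin_appE (L : language) n (f : funsym n) ts :
  tin L (App f ts) -> L n f /\ (forall i, tin L (ts i)).
Proof.
by move=> tL; split=> [|i m g gi]; apply: tL; [left | right; exists i].
Qed.

Lemma tin_subst L s t :
  tin L t -> (forall i, tin L (s i)) -> tin L (tsubst s t).
Proof.
move=> + sL; elim: t => [i||t IH|n f ts IH] //= /tin_appE[Lf tsL].
by apply: tin_app => // i; apply: IH.
Qed.

(** Substitution discards no function symbol of [t]. This gives back the language condition where a
    rule passes from an instance to the formula itself, as exists-introduction does. *)
Lemma tin_unsubst L s t : tin L (tsubst s t) -> tin L t.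
Proof.
elim: t => [i _ n f []||t IH|n f ts IH] //= /tin_appE[Lf tsL].
by apply: tin_app => // i; apply: IH.
Qed.

Lemma tin_sub (L L' : language) t :
  (forall n f, L n f -> L' n f) -> tin L t -> tin L' t.
Proof. by move=> sLL tL n f ft; apply/sLL/tL. Qed.

Lemma tin_up L s : (forall i, tin L (s i)) -> forall i, tin L (subst_up s i).
Proof. by move=> sL [|i] //=; apply: tin_subst. Qed.

Lemma fin_subst L s A :
  fin L A -> (forall i, tin L (s i)) -> fin L (fsubst s A).
Proof.
move=> + sL; elim: A s sL => [|t u|A IA B IB|A IA B IB|A IA B IB|A IA|A IA] s sL //=.
- by move=> [tL uL]; split; apply: tin_subst.
- by move=> [/(IA _ sL) ? /(IB _ sL)].
- by move=> [/(IA _ sL) ? /(IB _ sL)].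
- by move=> [/(IA _ sL) ? /(IB _ sL)].
- by apply: IA; apply: tin_up.
- by apply: IA; apply: tin_up.
Qed.

Lemma fin_unsubst L s A : fin L (fsubst s A) -> fin L A.
Proof.
elim: A s => [|t u|A IA B IB|A IA B IB|A IA B IB|A IA|A IA] s //=.
- by move=> [/tin_unsubst ? /tin_unsubst].
- by move=> [/IA ? /IB].
- by move=> [/IA ? /IB].
- by move=> [/IA ? /IB].
- by move=> /IA.
- by move=> /IA.
Qed.

Lemma fin_sub (L L' : language) A :
  (forall n f, L n f -> L' n f) -> fin L A -> fin L' A.
Proof.
move=> sLL; elim: A => //= [t u []|A IA B IB []|A IA B IB []|A IA B IB []];
  by [move=> /(tin_sub sLL) ? /(tin_sub sLL) | move=> /IA ? /IB].
Qed.

Lemma fin_inst L t A : fin L A -> tin L t -> fin L (inst t A).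
Proof. by move=> AL tL; apply: fin_subst => // -[]. Qed.

Lemma fin_iter_all L k A : fin L (iter k All A) = fin L A.
Proof. by elim: k. Qed.

Lemma fin_thA P A : thA P A -> fin (lang P) A.
Proof.
case=> [E PE|||B BL] /=; last 1 first.
- by do !split=> //; apply: fin_subst => // -[|i] //; apply: tin_succ.
- by rewrite /Defs.closure fin_iter_all; split=> n f oc; exists E; auto.
- by split=> //; split=> //; apply: tin_succ.
- by do !split=> //; apply: tin_succ.
Qed.

Definition fin_ctx (L : language) (G : seq form) : Prop :=
  forall A, List.In A G -> fin L A.

Lemma fin_cons L G A : fin L A -> fin_ctx L G -> fin_ctx L (A :: G).
Proof. by move=> ? ? C /= [<-|]; auto. Qed.

Lemma fin_map L G : fin_ctx L G -> fin_ctx L (map shift G).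
Proof. by move=> GL C /List.in_map_iff[D [<- /GL DL]]; apply: fin_subst. Qed.

(** The elimination rules carry no language condition on the formula they eliminate. It is recovered
    here, for use when a derivation is rebuilt rule by rule. *)
Lemma fin_nd P B G A : fin_ctx (lang P) G ->
  nd (lang P) (thA P) B G A -> fin (lang P) A.
Proof.
move=> + d; elim: d => {G A} /=.
- by move=> G A /fin_thA.
- by move=> G A inG; apply.
- by [].
- by move=> G A C AL _ IH GL; split=> //; apply/IH/fin_cons.
- by move=> G A C _ IH _ _ /IH[].
- by move=> G A C _ IA _ IC GL; split; auto.
- by move=> G A C _ IH /IH[].
- by move=> G A C _ IH /IH[].
- by move=> G A C CL _ IH /IH.
- by move=> G A C CL _ IH /IH.
- by move=> G A C D _ IH _ IA _ _ GL; apply/IA/fin_cons => //; case: (IH GL).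
- by move=> G A _ IH /fin_map /IH.
- by move=> G A t tL _ _ IH /IH; move/fin_inst; apply.
- by move=> G A t tL _ _ IH /IH /fin_unsubst.
- move=> G A C _ IA _ IC GL; have := IC (fin_cons (IA GL) (fin_map GL)).
  exact: fin_unsubst.
- by [].
- by move=> G A t s _ IA _ IE GL; case: (IE GL) => _; move/fin_inst; apply;
    apply: fin_unsubst (IA GL).
Qed.

(** * Derivations with basic terms *)

Local Notation basic_nd P := (nd (lang P) (thA P) basic).

Definition tot (t : term) : form := Ex (Eqn (tsubst (fun i => Var i.+1) t) (Var 0)).

Lemma fsubst_tot s t : fsubst s (tot t) = tot (tsubst s t).
Proof. by rewrite /tot /= !tsubst_comp. Qed.

Lemma nd_sym L Ax B G t s : nd L Ax B G (Eqn t s) -> tin L t ->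
  nd L Ax B G (Eqn s t).
Proof.
move=> eq_ts tL.
have E u : Eqn u t = inst u (Eqn (Var 0) (tsubst (fun i => Var i.+1) t)).
  by rewrite /inst /= tsubst_comp tsubst_id.
by rewrite E; apply: NdSubst eq_ts; rewrite -E; apply: NdRefl.
Qed.

Lemma nd_eq_tot L Ax B G t s :
  nd L Ax B G (Eqn t s) -> tin L t -> nd L Ax B G (tot s) -> nd L Ax B G (tot t).
Proof.
move=> eq_ts tL tot_s; have E u : tot u = inst u (Ex (Eqn (Var 1) (Var 0))) by [].
by rewrite E; apply: NdSubst (nd_sym eq_ts tL); rewrite -E.
Qed.

Lemma nd_basic_tot L Ax G t : basic t -> tin L t -> nd L Ax basic G (tot t).
Proof.
move=> bt tL; apply: (NdExI tL bt).
by rewrite /inst /= tsubst_comp tsubst_id; apply: NdRefl.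
Qed.

(** Forall-elimination at a total term: take y with t = y, instantiate at the variable y, which is
    basic, and rewrite y to t. *)
Lemma nd_all_tot L Ax G A t : fin L A -> tin L t ->
  nd L Ax basic G (All A) -> nd L Ax basic G (tot t) ->
  nd L Ax basic G (inst t A).
Proof.
(* Both derivations are cut in as premises of implications, so that neither has to be weakened to
   the context that contains the equation t = y. *)
move=> AL tL dA; apply: NdImpE; apply: NdImpE dA.
apply: NdImpI => //; apply: NdImpI => /=.
  by split=> //; apply: tin_subst.
apply: NdExE; first by apply: NdHyp; left.
rewrite shift_inst.
apply: (@NdSubst _ _ _ _ _ (Var 0)).
  by apply: NdAllE => //; apply: NdHyp; right; right; left.
apply: nd_sym; last exact: tin_subst.
by apply: NdHyp; left.
Qed.

(** Dual to forall-elimination: the premise A[t] is rewritten to A[y], and the variable y is the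
    basic witness. *)
Lemma nd_ex_tot L Ax G A t : fin L A -> tin L t ->
  nd L Ax basic G (inst t A) -> nd L Ax basic G (tot t) ->
  nd L Ax basic G (Ex A).
Proof.
move=> AL tL dA; apply: NdImpE; apply: NdImpE dA.
apply: NdImpI; first exact: fin_inst.
apply: NdImpI => /=; first by split=> //; apply: tin_subst.
apply: NdExE; first by apply: NdHyp; left.
apply: (@NdExI _ _ _ _ _ (Var 0)) => //.
apply: (@NdSubst _ _ _ _ _ (tsubst (fun i => Var i.+1) t)).
  by rewrite -shift_inst; apply: NdHyp; right; right; left.
by apply: NdHyp; left.
Qed.

Lemma nd_succ_tot L Ax G t : tin L t ->
  nd L Ax basic G (tot t) -> nd L Ax basic G (tot (Succ t)).
Proof.
move=> tL tot_t.
(* The sentence [forall x, exists y, S(x) = y] has the basic witness S(x); it is then instantiated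
   at the total term t. *)
have -> : tot (Succ t) = inst t (Ex (Eqn (Succ (Var 1)) (Var 0))) by [].
apply: nd_all_tot => //; first by split; auto.
apply: NdAllI.
by apply: (@NdExI _ _ _ _ _ (Succ (Var 0))) => //; apply: NdRefl.
Qed.

Lemma nd_all_iter L Ax B k G A :
  (forall H, nd L Ax B H A) -> nd L Ax B G (iter k All A).
Proof. by move=> dA; elim: k G => [|k IH] G; [exact: dA | apply: NdAllI]. Qed.

(** Simultaneous instantiation of k quantifiers. The other free variables drop by k because k
    binders disappear. The induction instantiates the outer quantifiers first and the innermost one,
    of index 0, last. *)
Lemma nd_iter_all_tot L Ax k G A s : fin L A ->
  (forall i, i < k -> tin L (s i)) ->
  (forall i, i < k -> nd L Ax basic G (tot (s i))) ->
  nd L Ax basic G (iter k All A) ->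
  nd L Ax basic G (fsubst (fun i => if i < k then s i else Var (i - k)) A).
Proof.
elim: k A s => [|k IH] A s AL sL sT.
  suff -> : fsubst (fun i => if i < 0 then s i else Var (i - 0)) A = A by [].
  have -> : (fun i => if i < 0 then s i else Var (i - 0)) = Var.
    by apply: functional_extensionality => i; rewrite subn0.
  exact: fsubst_id.
rewrite iterSr => /(IH (All A) (fun i => s i.+1) AL (fun i => sL i.+1)).
move=> /(_ (fun i => sT i.+1)) /= dA.
have fin_A : fin L (fsubst (subst_up (fun i => if i < k then s i.+1 else Var (i - k))) A).
  by apply: fin_subst => //; apply: tin_up => i; case: ifP => // lt_ik; apply: sL.
have := nd_all_tot fin_A (sL 0 isT) dA (sT 0 isT).
rewrite /inst fsubst_comp; congr (nd _ _ _ _ (fsubst _ _)).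
apply: functional_extensionality => -[|i] //=.
by rewrite tsubst_comp /= tsubst_id.
Qed.

Lemma nd_equation_tot P G E s : P E ->
  let k := maxn (tbound E.1) (tbound E.2) in
  (forall i, i < k -> tin (lang P) (s i)) ->
  (forall i, i < k -> basic_nd P G (tot (s i))) ->
  basic_nd P G (Eqn (tsubst s E.1) (tsubst s E.2)).
Proof.
move=> PE k sL sT; have AxE := ThEqn PE.
have := nd_iter_all_tot _ sL sT (NdAx _ _ _ AxE).
have := fin_thA AxE; rewrite /Defs.closure fin_iter_all => /[swap] /[apply] /=.
rewrite (@tsubst_ext _ s E.1) 1?(@tsubst_ext _ s E.2) // => i lt_i;
  by rewrite (leq_trans lt_i) // leq_max leqnn ?orbT.
Qed.

(** * Provable totality of the primitive recursive functions *)

Definition extends_PR (P : equation -> Prop) := forall E, PR E -> P E.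

Lemma defeqs_PR n (p : prim n) E : List.In E (defeqs p) -> PR E.
Proof. by exists n, p. Qed.

Lemma lang_Pr P n (p : prim n) : extends_PR P -> lang P (Pr p).
Proof.
move=> PRP; have PE E : List.In E (defeqs p) -> P E by move/defeqs_PR/PRP.
suff [ts [s inE]] : exists ts s, List.In (App (Pr p) ts, s) (defeqs p).
  by exists (App (Pr p) ts, s); [apply: PE | left; left].
by case: {PE} p => *; do 2!eexists; left.
Qed.

Lemma tin_Pr P n (p : prim n) ts : extends_PR P ->
  (forall i, tin (lang P) (ts i)) -> tin (lang P) (App (Pr p) ts).
Proof. by move=> PRP; apply: tin_app; apply: lang_Pr. Qed.

(** An upper bound for [lang PR] by the shape of the symbol, which suits induction on terms better
    than occurrence in some equation. *)
Definition Pr_only : language := fun n f => exists p, f = Pr p.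

Lemma tin_Pr_only n (p : prim n) ts :
  (forall i, tin Pr_only (ts i)) -> tin Pr_only (App (Pr p) ts).
Proof. by apply: tin_app; exists p. Qed.

Lemma lang_PR n (f : funsym n) : lang PR f -> Pr_only f.
Proof.
case=> E [m [p]].
suff: forall E, List.In E (defeqs p) -> tin Pr_only E.1 /\ tin Pr_only E.2.
  by move=> H /H[E1 E2] [oc|oc]; [apply: E1 | apply: E2].
case: {E f} p => [k||k i|k l h g|k g h] E /=.
- by case=> // <-; split=> //; apply: tin_Pr_only.
- by case=> // <-; split=> //=; auto; apply: tin_Pr_only.
- by case=> // <-; split=> //; apply: tin_Pr_only.
- by case=> // <-; split=> /=; do !apply: tin_Pr_only => // ?.
case=> [|[|//]] <-; split; do ![apply: tin_Pr_only => // | apply: forall_vcons => //]; auto.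
Qed.

(** The context is arbitrary so that totality can be used under hypotheses without a weakening
    lemma. *)
Definition prim_tot P n (p : prim n) : Prop :=
  forall G, basic_nd P G (iter n All (tot (App (Pr p) (@vars n)))).

Lemma tin_tot L t : tin L t -> fin L (tot t).
Proof. by move=> tL; split=> //; apply: tin_subst. Qed.

Lemma nd_app_tot P n (p : prim n) G ts : extends_PR P -> prim_tot P p ->
  (forall i, tin (lang P) (ts i)) ->
  (forall i, basic_nd P G (tot (ts i))) ->
  basic_nd P G (tot (App (Pr p) ts)).
Proof.
(* The vector of arguments is extended to all indices; the value [Zero] from n on is never
   reached. *)
move=> PRP p_tot tsL tsT; pose s i := if insub i is Some j then ts j else Zero.
have sE (j : 'I_n) : s j = ts j by rewrite /s valK.
have /nd_iter_all_tot := p_tot G => /(_ s) d.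
have {d} := d (tin_tot (tin_Pr PRP _)).
have -> : fsubst (fun i => if i < n then s i else Var (i - n))
    (tot (App (Pr p) (@vars n))) = tot (App (Pr p) ts).
  rewrite /tot /=; congr (Ex (Eqn (App _ _) _)).
  by apply: functional_extensionality => i; rewrite /= ltn_ord sE.
apply=> // i lt_in; rewrite -[i]/(val (Ordinal lt_in)) sE //.
Qed.

(** Induction on the definition of p: the defining equation reduces totality of p to that of its
    constituents, and primitive recursion uses the induction axiom on the recursion argument. *)
Lemma nd_prim_tot P n (p : prim n) : extends_PR P -> prim_tot P p.
Proof.
move=> PRP; have PRP' m (q : prim m) E : List.In E (defeqs q) -> P E.
  by move/defeqs_PR/PRP.
have var_tot G i : basic_nd P G (tot (Var i)) by apply: nd_basic_tot.
have axiom m (q : prim m) E G s : List.In E (defeqs q) ->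
    (forall i, tin (lang P) (s i)) -> (forall i, basic_nd P G (tot (s i))) ->
    basic_nd P G (Eqn (tsubst s E.1) (tsubst s E.2)).
  by move=> /PRP' PE sL sT; apply: nd_equation_tot.
have axiom_var m (q : prim m) E G : List.In E (defeqs q) ->
    basic_nd P G (Eqn E.1 E.2).
  by move=> inE; rewrite -[E.1]tsubst_id -[E.2]tsubst_id; apply: (axiom m q).
elim: {n} p => [n||n i|n m h IHh g IHg|n g IHg h IHh] G.
- apply: nd_all_iter => {}G; have /= eq := @axiom_var _ (PZero n) _ G (or_introl erefl).
  apply: nd_eq_tot eq _ _.
    exact: tin_Pr.
  exact: nd_basic_tot.
- apply: nd_all_iter => {}G; have /= eq := @axiom_var _ PSucc _ G (or_introl erefl).
  apply: nd_eq_tot eq _ _.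
    exact: tin_Pr.
  by apply: nd_basic_tot; auto.
- apply: nd_all_iter => {}G; have /= eq := @axiom_var _ (PProj i) _ G (or_introl erefl).
  apply: nd_eq_tot eq _ _.
    exact: tin_Pr.
  exact: nd_basic_tot.
- apply: nd_all_iter => {}G; have /= eq := @axiom_var _ (PComp h g) _ G (or_introl erefl).
  apply: nd_eq_tot eq _ _.
    exact: tin_Pr.
  apply: nd_app_tot => // i; first exact: tin_Pr.
  by apply: nd_app_tot => // j; apply: var_tot.
(* The recursion argument has index 0, hence the innermost quantifier; that quantifier is kept for
   the induction axiom, and the parameters become free. *)
rewrite iterSr; apply: nd_all_iter => {}G.
set x_ := fun i : 'I_n => Var i.+1; have x_L i : tin (lang P) (x_ i) by exact: tin_var.
have -> : @vars n.+1 = vcons (Var 0) x_ by rewrite [LHS]vcons_eta.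
have recL t (us : 'I_n -> term) : tin (lang P) t -> (forall i, tin (lang P) (us i)) ->
    tin (lang P) (App (Pr (PRec g h)) (vcons t us)).
  by move=> tL usL; apply: tin_Pr => //; apply: forall_vcons.
have A_L : fin (lang P) (tot (App (Pr (PRec g h)) (vcons (Var 0) x_))).
  by apply: tin_tot; apply: recL.
apply: NdImpE (NdImpE (NdAx _ _ _ (ThInd A_L)) _) _.
(* Instantiating index 0 by [Zero] lowers the parameters by one, so the base equation, whose
   parameters start at index 1, is lowered as well. *)
- have /= := @axiom _ (PRec g h) _ G (fun i => Var i.-1) (or_introl erefl).
  rewrite !map_vcons /= => /(_ (fun=> @tin_var _ _) (fun i => var_tot _ _)) eq0.
  rewrite /inst fsubst_tot /= map_vcons /=.
  apply: nd_eq_tot eq0 _ _; first by apply: recL.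
  by apply: nd_app_tot => // i; apply: var_tot.
apply: NdAllI; apply: NdImpI => //; set H := _ :: _.
have /= eqS := @axiom_var _ (PRec g h) _ H (or_intror (or_introl erefl)).
rewrite /inst_succ fsubst_tot /= map_vcons /=.
apply: nd_eq_tot eqS _ _; first by apply: recL; auto.
have stepL : forall i, tin (lang P) (vcons (Var 0) (vcons
    (App (Pr (PRec g h)) (vcons (Var 0) x_)) x_) i).
  by do 2![apply: forall_vcons => //]; apply: recL.
apply: nd_app_tot => //.
apply: (forall_vcons (Q := fun t => basic_nd P H (tot t))) => //.
apply: (forall_vcons (Q := fun t => basic_nd P H (tot t))) => //.
(* The previous value is total by the induction hypothesis. *)
by apply: NdHyp; left.
Qed.

Lemma nd_Pr_only_tot P G t : extends_PR P -> tin Pr_only t -> basic_nd P G (tot t).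
Proof.
move=> PRP; have PL n (f : funsym n) : Pr_only f -> lang P f.
  by case=> p ->; apply: lang_Pr.
elim: t => [i _|_|t IH tL|n f ts IH /tin_appE[[p ->] tsL]]; try exact: nd_basic_tot.
  by apply: nd_succ_tot; [apply: (tin_sub PL) tL | apply: IH].
apply: nd_app_tot => // [|i|i]; first exact: nd_prim_tot; last exact: IH.
exact: tin_sub PL (tsL i).
Qed.

(** All rules are copied except forall-elimination and exists-introduction, whose terms are total
    because they lie over the primitive recursive symbols. The condition on [G] lets [fin_nd] supply
    the language conditions for these two rules and for the contexts extended by elimination
    rules. *)
Lemma nd_basic_of_PR P G A : extends_PR P ->
  fin_ctx (lang PR) G ->
  nd (lang PR) (thA PR) (fun=> True) G A -> basic_nd P G A.
Proof.
move=> PRP + d.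
have PL n (f : funsym n) : lang PR f -> lang P f.
  by move=> /lang_PR[p ->]; apply: lang_Pr.
have tot_PR H t : tin (lang PR) t -> basic_nd P H (tot t).
  by move=> tL; apply: nd_Pr_only_tot => //; apply: tin_sub tL => n f; apply: lang_PR.
elim: d => {G A}.
- move=> G A AxA GL; apply: NdAx; case: AxA => [E /PRP|||B BL].
  + exact: ThEqn.
  + exact: ThSuccNeq0.
  + exact: ThSuccInj.
  + exact/ThInd/(fin_sub PL).
- by move=> G A inG GL; apply: NdHyp.
- move=> G A AL _ IH GL; apply: NdRaa; first exact: fin_sub AL.
  by apply/IH/fin_cons.
- move=> G A C AL _ IH GL; apply: NdImpI; first exact: fin_sub AL.
  by apply/IH/fin_cons.
- by move=> G A C _ IH _ IA GL; apply: NdImpE (IH GL) (IA GL).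
- by move=> G A C _ IA _ IC GL; apply: NdAndI (IA GL) (IC GL).
- by move=> G A C _ IH GL; apply: NdAndE1 (IH GL).
- by move=> G A C _ IH GL; apply: NdAndE2 (IH GL).
- by move=> G A C CL _ IH GL; apply: NdOrI1 (IH GL); apply: fin_sub CL.
- by move=> G A C CL _ IH GL; apply: NdOrI2 (IH GL); apply: fin_sub CL.
- move=> G A C D dAC IH _ IA _ IC GL; have [AL CL] := fin_nd GL dAC.
  by apply: NdOrE (IH GL) (IA _) (IC _); apply: fin_cons.
- by move=> G A _ IH GL; apply/NdAllI/IH/fin_map.
- move=> G A t tL _ dA IH GL; apply: nd_all_tot (IH GL) (tot_PR _ _ tL).
    exact: fin_sub PL (fin_nd GL dA).
  exact: tin_sub tL.
- move=> G A t tL _ dA IH GL; apply: nd_ex_tot (IH GL) (tot_PR _ _ tL).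
    exact: fin_sub PL (fin_unsubst (fin_nd GL dA)).
  exact: tin_sub tL.
- move=> G A C dA IH _ IC GL; apply: NdExE (IH GL) (IC _).
  by apply: fin_cons (fin_map GL); apply: fin_nd GL dA.
- by move=> G t tL GL; apply: NdRefl; apply: tin_sub tL.
- by move=> G A t s _ IA _ IE GL; apply: NdSubst (IA GL) (IE GL).
Qed.

(** * The standard model *)

Fixpoint peval n (p : prim n) : ('I_n -> nat) -> nat :=
  match p in prim n return ('I_n -> nat) -> nat with
  | PZero _ => fun=> 0
  | PSucc => fun v => (v ord0).+1
  | PProj _ i => fun v => v i
  | PComp _ _ h g => fun v => peval h (fun j => peval (g j) v)
  | PRec _ g h => fun v =>
      let w j := v (lift ord0 j) in
      nat_rect (fun=> nat) (peval g w) (fun k r => peval h (vcons k (vcons r w)))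
        (v ord0)
  end.

Lemma peval_rec0 n (g : prim n) h v : peval (PRec g h) (vcons 0 v) = peval g v.
Proof.
rewrite /= vcons0; congr (peval g _).
by apply: functional_extensionality => j; rewrite vconsS.
Qed.

Lemma peval_recS n (g : prim n) h k v :
  peval (PRec g h) (vcons k.+1 v) =
  peval h (vcons k (vcons (peval (PRec g h) (vcons k v)) v)).
Proof.
rewrite /= !vcons0 /=; suff -> : (fun j => vcons k.+1 v (lift ord0 j)) = v.
  suff -> : (fun j => vcons k v (lift ord0 j)) = v by [].
  by apply: functional_extensionality => j; rewrite vconsS.
by apply: functional_extensionality => j; rewrite vconsS.
Qed.

(** Only the symbols [Usr] are left to interpret: the domain is the natural numbers, and primitive
    recursive symbols always denote the functions they define. *)
Definition structure := forall n, nat -> ('I_n -> nat) -> nat.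

Definition fval (I : structure) n (f : funsym n) : ('I_n -> nat) -> nat :=
  match f with Pr p => peval p | Usr k => @I n k end.

Fixpoint teval (I : structure) (env : nat -> nat) (t : term) : nat :=
  match t with
  | Var i => env i
  | Zero => 0
  | Succ t => (teval I env t).+1
  | App _ f ts => fval I f (fun i => teval I env (ts i))
  end.

Definition scons (a : nat) (env : nat -> nat) : nat -> nat :=
  fun i => if i is j.+1 then env j else a.

Fixpoint sat (I : structure) (env : nat -> nat) (A : form) : Prop :=
  match A with
  | Bot => False
  | Eqn t s => teval I env t = teval I env s
  | Imp A B => sat I env A -> sat I env B
  | And A B => sat I env A /\ sat I env B
  | Or A B => sat I env A \/ sat I env B
  | All A => forall a, sat I (scons a env) A
  | Ex A => exists a, sat I (scons a env) A
  end.

Definition valid I (E : equation) := forall env, teval I env E.1 = teval I env E.2.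

Lemma teval_num I env k : teval I env (num k) = k.
Proof. by elim: k => //= k ->. Qed.

Lemma teval_subst I env s t :
  teval I env (tsubst s t) = teval I (fun i => teval I env (s i)) t.
Proof.
elim: t => [i||t IH|n f ts IH] //=; first by rewrite IH.
by congr fval; apply: functional_extensionality.
Qed.

Lemma teval_up I env s a :
  (fun i => teval I (scons a env) (subst_up s i)) =
  scons a (fun i => teval I env (s i)).
Proof.
apply: functional_extensionality => -[|i] //=; rewrite teval_subst.
by congr teval; apply: functional_extensionality.
Qed.

Lemma sat_subst I env s A :
  sat I env (fsubst s A) <-> sat I (fun i => teval I env (s i)) A.
Proof.
elim: A env s => [|t u|A IA B IB|A IA B IB|A IA B IB|A IA|A IA] env s //=.
- by rewrite !teval_subst.
- by rewrite IA IB.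
- by rewrite IA IB.
- by rewrite IA IB.
- by split=> sA a; move: (sA a); rewrite IA teval_up.
- by split=> -[a]; rewrite ?IA => sA; exists a; move: sA; rewrite ?IA teval_up.
Qed.

Lemma sat_shift I env a A : sat I (scons a env) (shift A) <-> sat I env A.
Proof. by rewrite sat_subst. Qed.

Lemma sat_inst I env t A : sat I env (inst t A) <-> sat I (scons (teval I env t) env) A.
Proof.
rewrite sat_subst; suff -> : scons (teval I env t) env =
  fun i => teval I env (if i is j.+1 then Var j else t) by [].
by apply: functional_extensionality => -[].
Qed.

Lemma sat_inst_succ I env a A :
  sat I (scons a env) (inst_succ A) <-> sat I (scons a.+1 env) A.
Proof.
rewrite sat_subst; suff -> : scons a.+1 env =
  fun i => teval I (scons a env) (if i is j.+1 then Var j.+1 else Succ (Var 0)) by [].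
by apply: functional_extensionality => -[].
Qed.

Lemma nd_sound I L Ax B G A :
  (forall C, Ax C -> forall env, sat I env C) -> nd L Ax B G A ->
  forall env, (forall C, List.In C G -> sat I env C) -> sat I env A.
Proof.
move=> Axs d.
have sat_cons env C H : sat I env C -> (forall D, List.In D H -> sat I env D) ->
  forall D, List.In D (C :: H) -> sat I env D by move=> ? ? D /= [<-|]; auto.
have sat_map env a H : (forall D, List.In D H -> sat I env D) ->
    forall D, List.In D (map shift H) -> sat I (scons a env) D.
  by move=> HH D /List.in_map_iff[D' [<- /HH sD]]; apply/sat_shift.
elim: d => {G A} /=.
- by move=> G A /Axs.
- by move=> G A inG env; apply.
(* Reductio ad absurdum is matched by classical reasoning about truth in the model. *)
- move=> G A _ _ IH env GH; apply: NNPP => nA.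
  exact: IH (sat_cons _ _ _ _ GH).
- by move=> G A C _ _ IH env GH sA; apply/IH/sat_cons.
- by move=> G A C _ IH _ IA env GH; apply: IH (IA _ GH).
- by move=> G A C _ IA _ IC env GH; split; [apply: IA | apply: IC].
- by move=> G A C _ IH env /IH[].
- by move=> G A C _ IH env /IH[].
- by move=> G A C _ _ IH env /IH; left.
- by move=> G A C _ _ IH env /IH; right.
- move=> G A C D _ IH _ IA _ IC env GH.
  by case: (IH _ GH) => [sA|sC]; [apply: IA | apply: IC]; apply: sat_cons.
- by move=> G A _ IH env GH a; apply/IH/sat_map.
- by move=> G A t _ _ _ IH env /IH sA; apply/sat_inst.
- by move=> G A t _ _ _ IH env /IH /sat_inst sA; exists (teval I env t).
- move=> G A C _ IA _ IC env GH; have [a sA] := IA _ GH.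
  by apply/(sat_shift _ _ a); apply/IC/sat_cons/sat_map.
- by [].
- move=> G A t s _ IA _ IE env GH; have /sat_inst := IA _ GH.
  by rewrite (IE _ GH) => sA; apply/sat_inst.
Qed.

Lemma sat_iter_all I env k A : (forall env, sat I env A) -> sat I env (iter k All A).
Proof. by move=> sA; elim: k env => [|k IH] env //= a; apply: IH. Qed.

Lemma thA_sound I P A : (forall E, P E -> valid I E) -> thA P A ->
  forall env, sat I env A.
Proof.
move=> PI [E /PI EI|||B _] env /=.
- exact: sat_iter_all.
- by [].
- by move=> a b [].
- move=> /sat_inst s0 sS; elim=> // a sa.
  by apply/sat_inst_succ/sS.
Qed.

Lemma provable_sound I P A : (forall E, P E -> valid I E) -> provable P A ->
  forall env, sat I env A.
Proof. by move=> /thA_sound PI d env; apply: (nd_sound PI d). Qed.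

Lemma eqprv_sound I P E : (forall E, P E -> valid I E) -> eqprv P E -> valid I E.
Proof.
move=> PI; elim=> {E}.
- by move=> E /PI.
- by [].
- by move=> x r t s _ IH env; rewrite /= !teval_subst; apply: IH.
- move=> x s r t t' _ IH _ Et env /=; have := IH env; rewrite /= !teval_subst.
  suff -> : (fun i => teval I env (if i == x then t else Var i)) =
            (fun i => teval I env (if i == x then t' else Var i)) by [].
  by apply: functional_extensionality => i; case: eqP => // _; apply: Et.
Qed.

Lemma PR_valid I E : PR E -> valid I E.
Proof.
case=> n [p]; case: p => {n} [n||n i|n m h g|n g h] /= inE env.
- by case: inE => // <-.
- by case: inE => // <-.
- by case: inE => // <-.
- by case: inE => // <-.
case: inE => [|[|//]] <-; rewrite -[LHS]/(peval (PRec g h) _) map_vcons.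
  by rewrite peval_rec0.
rewrite peval_recS -[RHS]/(peval h _) map_vcons; congr (peval h (vcons _ _)).
by rewrite map_vcons -[X in _ = vcons X _]/(peval (PRec g h) _) map_vcons.
Qed.

(** * Arithmetization of Turing machines *)

Lemma vcons_ord0 T n (a : T) (v : 'I_n -> T) (lt_0 : 0 < n.+1) :
  vcons a v (Ordinal lt_0) = a.
Proof. by rewrite -[RHS](vcons0 a v); congr vcons; apply: val_inj. Qed.

Lemma vcons_ordS T n (a : T) (v : 'I_n -> T) i (lt_i : i.+1 < n.+1) :
  vcons a v (Ordinal lt_i) = v (Ordinal (lt_i : i < n)).
Proof. by rewrite -(vconsS a v); congr vcons; apply: val_inj. Qed.

Lemma peval_comp n m (h : prim m) (g : 'I_m -> prim n) v :
  peval (PComp h g) v = peval h (fun j => peval (g j) v).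
Proof. by []. Qed.

Lemma peval_proj n (i : 'I_n) v : peval (PProj i) v = v i.
Proof. by []. Qed.

Lemma peval_zero n v : peval (PZero n) v = 0.
Proof. by []. Qed.

Lemma peval_succ a : peval PSucc [@ a] = a.+1.
Proof. by rewrite /= vcons0. Qed.

Lemma peval_vcons n m (a : prim n) (w : 'I_m -> prim n) v :
  (fun j => peval (vcons a w j) v) = vcons (peval a v) (fun j => peval (w j) v).
Proof. exact: (map_vcons (fun p => peval p v)). Qed.

Lemma peval_vnil n v : (fun j => peval (@vnil (prim n) j) v) = vnil.
Proof. exact: (map_vnil (fun p => peval p v)). Qed.

Lemma peval_proj2 n a b (v : 'I_n -> nat) :
  (fun j => peval (PProj (lift ord0 (lift ord0 j))) (vcons a (vcons b v))) = v.
Proof. by apply: functional_extensionality => j; rewrite /= !vconsS. Qed.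

Definition pargE :=
  (peval_vcons, peval_vnil, peval_proj2, vcons_ord0, vcons_ordS, peval_proj).

(* [peval_comp] comes last, and is elsewhere given [h] explicitly, because it
   also matches defined symbols such as [psub] and would unfold them. *)
Definition pevalE :=
  (pargE, peval_rec0, peval_recS, peval_zero, peval_succ, peval_comp).

Lemma peval_const n k v : peval (pconst n k) v = k.
Proof. by elim: k => //= k IH; rewrite vcons0 IH. Qed.

Lemma peval_add a b : peval padd [@ a; b] = a + b.
Proof. by elim: a => [|a IH]; rewrite /padd !pevalE // -/padd IH. Qed.

Lemma peval_mul a b : peval pmul [@ a; b] = a * b.
Proof.
by elim: a => [|a IH]; rewrite /pmul !(peval_add, pevalE) // -/pmul IH mulSnr.
Qed.

Lemma peval_pred a : peval ppred [@ a] = a.-1.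
Proof. by case: a => [|a]; rewrite /ppred !pevalE. Qed.

Lemma peval_sub a b : peval psub [@ a; b] = a - b.
Proof.
rewrite /psub !pevalE; elim: b => [|b IH]; rewrite !(peval_pred, pevalE) ?subn0 //.
by rewrite IH subnS.
Qed.

Lemma peval_not a : peval pnot [@ a] = (a == 0).
Proof. by case: a => [|a]; rewrite /pnot !(peval_const, pevalE). Qed.

Lemma peval_true a : peval ptrue [@ a] = (a != 0).
Proof. by rewrite /ptrue !(peval_not, pevalE) eqb0. Qed.

Lemma peval_if c a b : peval pif [@ c; a; b] = if c != 0 then a else b.
Proof. by case: c => [|c]; rewrite /pif !pevalE. Qed.

Lemma peval_eq a b : peval peq [@ a; b] = (a == b).
Proof.
rewrite /peq !(peval_not, peval_add, peval_sub, pevalE).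
by rewrite addn_eq0 !subn_eq0 eqn_leq.
Qed.

Definition peval_ariE :=
  (peval_const, peval_add, peval_mul, peval_pred, peval_sub, peval_not,
   peval_true, peval_if, peval_eq).

Lemma peval_all n (body : prim n.+1) k v :
  (peval (pall body) (vcons k v) != 0) =
  all (fun i => peval body (vcons i v) != 0) (iota 0 k).
Proof.
elim: k => [|k IH]; first by rewrite /pall !(peval_const, pevalE).
rewrite /pall !(peval_ariE, pevalE) -/(pall body) muln_eq0 negb_or IH.
by rewrite -[k.+1]addn1 iotaD all_cat /= andbT andbC.
Qed.

Lemma peval_ex n (body : prim n.+1) k v :
  (peval (pex body) (vcons k v) != 0) =
  has (fun i => peval body (vcons i v) != 0) (iota 0 k).
Proof.
rewrite /pex !(peval_not, pevalE) eqb0 peval_all -has_predC.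
apply: eq_has => i; rewrite -[LHS]/(~~ (peval (PComp pnot [@ body]) (vcons i v) != 0)).
by rewrite !(peval_not, pevalE) eqb0 negbK.
Qed.

(** Bounded summation serves for counting: applied to truth values, it gives the length of a trace
    and the number of strokes on a tape. *)
Definition psum n (body : prim n.+1) : prim n.+1 :=
  PRec (PZero n)
    (PComp padd
       [@ PComp body
            (vcons (arg n.+2 0) (fun j => PProj (lift ord0 (lift ord0 j))));
          arg n.+2 1]).

Lemma peval_sum n (body : prim n.+1) k v :
  peval (psum body) (vcons k v) = \sum_(i < k) peval body (vcons (i : nat) v).
Proof.
elim: k => [|k IH]; first by rewrite big_ord0 /psum !pevalE.
by rewrite /psum !(peval_ariE, pevalE) -/(psum body) IH addnC big_ord_recr.
Qed.

(** * Coded sequences *)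

Lemma peval_pow2 a : peval ppow2 [@ a] = 2 ^ a.
Proof.
elim: a => [|a IH]; rewrite /ppow2 !(peval_ariE, pevalE) // -/ppow2 IH.
by rewrite addnn -mul2n expnS.
Qed.

Lemma peval_odd a : peval podd [@ a] = odd a.
Proof.
elim: a => [|a IH]; rewrite /podd !(peval_ariE, pevalE) // -/podd IH eqb0 //.
Qed.

Lemma peval_half a : peval phalf [@ a] = a./2.
Proof.
elim: a => [|a IH]; rewrite /phalf !(peval_odd, peval_ariE, pevalE) // -/phalf IH.
by rewrite -uphalf_half.
Qed.

Lemma peval_cons a s : peval pcons [@ a; s] = 2 ^ a * s.*2.+1.
Proof. by rewrite /pcons !(peval_pow2, peval_ariE, pevalE) addnn. Qed.

Definition strip (c : nat) : nat := if odd c then c else c./2.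

Lemma peval_strip i c : peval pstrip [@ i; c] = iter i strip c.
Proof.
elim: i => [|i IH]; rewrite /pstrip !(peval_odd, peval_half, peval_ariE, pevalE) //.
by rewrite -/pstrip IH iterS /strip eqb0 negbK.
Qed.

(** Each step removes one factor 2 until the odd part remains, which is then fixed; truncated
    subtraction covers the case i > a. *)
Lemma iter_strip_code i a m :
  iter i strip (2 ^ a * m.*2.+1) = 2 ^ (a - i) * m.*2.+1.
Proof.
elim: i => [|i IH]; first by rewrite subn0.
rewrite iterS IH /strip subnS; case: (a - i) => [|b].
  by rewrite expn0 mul1n /= odd_double.
by rewrite expnS -mulnA mul2n odd_double doubleK.
Qed.

Lemma iter_strip0 i : iter i strip 0 = 0.
Proof. by elim: i => //= i ->. Qed.

(** This is why a code can bound the quantifiers and sums that range over the positions of the coded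
    sequence. *)
Lemma size_code s : size s <= CodeSeq.code s.
Proof.
elim: s => //= a s IH; rewrite -[(size s).+1]mul1n leq_mul ?expn_gt0 //.
by rewrite ltnS (leq_trans IH) // -addnn leq_addr.
Qed.

Lemma code_eq0 s : (CodeSeq.code s == 0) = (s == [::]).
Proof. by case: s => //= a s; rewrite muln_eq0 expn_eq0. Qed.

Lemma leq_head_code s : head 0 s <= CodeSeq.code s.
Proof. by case: s => //= a s; rewrite ltnW // -[a.+1]muln1 leq_mul // ltn_expl. Qed.

Lemma sum_ltn k a : \sum_(i < k) (i < a) = minn k a.
Proof.
elim: k => [|k IH]; first by rewrite big_ord0 min0n.
by rewrite big_ord_recr /= IH; case: (ltnP k a) => /= ?; lia.
Qed.

Lemma peval_behead s : peval pbehead [@ CodeSeq.code s] = CodeSeq.code (behead s).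
Proof.
rewrite /pbehead !(peval_half, peval_strip, pevalE); case: s => [|a s].
  by rewrite iter_strip0.
rewrite -[X in iter X]/(CodeSeq.code (a :: s)) iter_strip_code.
(* Read as a vanishing difference, the bound says that c halvings suffice to strip all factors 2
   from the code c. *)
have /eqP-> := leq_head_code (a :: s).
by rewrite mul1n /= uphalf_double.
Qed.

Lemma peval_head s : peval phead [@ CodeSeq.code s] = head 0 s.
Proof.
rewrite /phead; set evens := PRec _ _.
have evensE k c : peval evens [@ k; c] = \sum_(i < k) ~~ odd (iter i strip c).
  elim: k => [|k IH]; rewrite /evens !(peval_odd, peval_strip, peval_ariE, pevalE).
    by rewrite big_ord0.
  by rewrite -/evens IH eqb0 addnC big_ord_recr.
rewrite peval_comp !pargE evensE.
case: s => [|a s]; first by rewrite /= big_ord0.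
(* After i steps the exponent of 2 is a - i, so the stripped number is even exactly when i < a. *)
transitivity (\sum_(i < CodeSeq.code (a :: s)) (i < a)).
  apply: eq_bigr => i _; rewrite iter_strip_code oddM [odd _.*2.+1]oddS odd_double.
  by rewrite andbT oddX orbF subn_eq0 -ltnNge.
by rewrite sum_ltn; apply/minn_idPr/(leq_head_code (a :: s)).
Qed.

Lemma peval_drop i s : peval pdrop [@ i; CodeSeq.code s] = CodeSeq.code (drop i s).
Proof.
elim: i => [|i IH]; first by rewrite /pdrop !pevalE drop0.
rewrite /pdrop peval_recS peval_comp !pargE -/pdrop IH.
by rewrite peval_behead -drop1 drop_drop add1n.
Qed.

Lemma peval_nth i s : peval pnth [@ i; CodeSeq.code s] = nth 0 s i.
Proof. by rewrite /pnth !(peval_drop, peval_head, pevalE) -nth0 nth_drop addn0. Qed.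

Lemma peval_field n i (p : prim n) v s : peval p v = CodeSeq.code s ->
  peval (field i p) v = nth 0 s i.
Proof. by move=> ps; rewrite /field peval_comp !pargE peval_const ps peval_nth. Qed.

(** * Coded machines and computations *)

Lemma peval_applicable i c :
  peval papplicable [@ code_instr i; code_config c] = applicable i c.
Proof.
case: i => [[[[q a] q'] b] rgt]; case: c => [[q0 l] r].
set ci := code_instr _; set cc := code_config _; set v := [@ ci; cc].
have fi k : peval (field k (arg 2 0)) v = nth 0 [:: q; a; q'; b; rgt : nat] k.
  by apply: peval_field; rewrite peval_proj /v !pargE.
have fc k : peval (field k (arg 2 1)) v =
    nth 0 [:: q0; CodeSeq.code l; CodeSeq.code r] k.
  by apply: peval_field; rewrite peval_proj /v !pargE.
rewrite /papplicable peval_comp !pargE peval_mul !(peval_comp peq) !pargE !peval_eq.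
by rewrite !fi fc peval_comp !pargE fc peval_head mulnb.
Qed.

Lemma peval_act i c :
  peval pact [@ code_instr i; code_config c] = code_config (act i c).
Proof.
case: i => [[[[q a] q'] b] rgt]; case: c => [[q0 l] r].
set ci := code_instr _; set cc := code_config _; set v := [@ ci; cc].
have fi k : peval (field k (arg 2 0)) v = nth 0 [:: q; a; q'; b; rgt : nat] k.
  by apply: peval_field; rewrite peval_proj /v !pargE.
have fc k : peval (field k (arg 2 1)) v =
    nth 0 [:: q0; CodeSeq.code l; CodeSeq.code r] k.
  by apply: peval_field; rewrite peval_proj /v !pargE.
have hdE (s : prim 2) t : peval s v = CodeSeq.code t ->
    peval (PComp phead [@ s]) v = head 0 t.
  by move=> sE; rewrite peval_comp !pargE sE peval_head.
have tlE (s : prim 2) t : peval s v = CodeSeq.code t ->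
    peval (PComp pbehead [@ s]) v = CodeSeq.code (behead t).
  by move=> sE; rewrite peval_comp !pargE sE peval_behead.
have consE (x s : prim 2) m t : peval x v = m -> peval s v = CodeSeq.code t ->
    peval (PComp pcons [@ x; s]) v = CodeSeq.code (m :: t).
  by move=> xE sE; rewrite peval_comp !pargE xE sE peval_cons.
have lE : _ = CodeSeq.code l := fc 1; have rE : _ = CodeSeq.code r := fc 2.
have nilE : peval (PZero 2) v = CodeSeq.code [::] by [].
rewrite /pact peval_comp !pargE peval_if fi.
have -> : (nth 0 [:: q; a; q'; b; rgt : nat] 4 != 0) = rgt by case: (rgt).
rewrite [act _ _]/=; case: (rgt).
  exact: consE (fi 2) (consE _ _ _ _ (consE _ _ _ _ (fi 3) lE)
    (consE _ _ _ _ (tlE _ _ rE) nilE)).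
exact: consE (fi 2) (consE _ _ _ _ (tlE _ _ lE)
  (consE _ _ _ _ (consE _ _ _ _ (hdE _ _ lE)
    (consE _ _ _ _ (fi 3) (tlE _ _ rE))) nilE)).
Qed.

Lemma ltn_size_machine (M : machine) i :
  CodeSeq.code (drop i (map code_instr M)) != 0 -> i < size M.
Proof. by rewrite code_eq0 -size_eq0 size_drop size_map subn_eq0 -ltnNge. Qed.

(** The number [d] is arbitrary; its equality with the value of [pact] forces it to code a
    configuration. The factor with [pdrop] excludes indices beyond the last instruction, where
    [pnth] would return its default 0. *)
Lemma peval_step M c d :
  peval pstep [@ code_machine M; code_config c; d] != 0 ->
  exists2 c', d = code_config c' & tm_step M c c'.
Proof.
rewrite /pstep peval_comp !pargE peval_ex => /hasP[i _].
rewrite peval_comp !pargE peval_mul muln_eq0 negb_or => /andP[].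
rewrite peval_comp !pargE peval_true peval_comp !pargE peval_drop eqb0 negbK.
move=> /ltn_size_machine lt_iM.
rewrite peval_comp !pargE peval_mul muln_eq0 negb_or (peval_comp papplicable) !pargE.
rewrite !(peval_comp pnth) !pargE peval_nth (nth_map (0, 0, 0, 0, false)) //.
set ins := nth _ M i; rewrite peval_applicable !eqb0 negbK => /andP[app_i].
rewrite (peval_comp peq) !pargE (peval_comp pact) !pargE (peval_comp pnth) !pargE.
rewrite peval_nth (nth_map (0, 0, 0, 0, false)) // -/ins peval_act peval_eq eqb0 negbK.
move=> /eqP ->; exists (act ins c) => //.
by apply/hasP; exists ins; rewrite ?mem_nth // app_i eqxx.
Qed.

Lemma peval_halted M c :
  peval phalted [@ code_machine M; code_config c] != 0 -> tm_halted M c.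
Proof.
rewrite /phalted peval_comp !pargE peval_all => /allP halted_c.
apply/hasPn => ins /(nthP (0, 0, 0, 0, false))[i lt_iM <-].
have /halted_c : i \in iota 0 (code_machine M).
  rewrite mem_iota (leq_trans lt_iM) // -[size M](size_map code_instr).
  exact: size_code.
rewrite peval_comp !pargE peval_not peval_comp !pargE peval_mul.
rewrite peval_comp !pargE peval_true peval_comp !pargE peval_drop.
rewrite code_eq0 -size_eq0 size_drop size_map subn_eq0 -ltnNge lt_iM mul1n.
rewrite peval_comp !pargE !(peval_comp pnth) !pargE peval_nth.
by rewrite (nth_map (0, 0, 0, 0, false)) // peval_applicable; case: applicable.
Qed.

(** What [plink] tests, read on the decoded suffix of the trace. The entries are plain numbers, not
    yet known to code configurations. *)
Definition link (M : machine) (t : seq nat) : bool :=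
  match t with
  | a :: b :: _ => peval pstep [@ code_machine M; a; b] != 0
  | [:: a] => peval phalted [@ code_machine M; a] != 0
  | [::] => true
  end.

Lemma peval_link M i t :
  (peval plink [@ i; code_machine M; CodeSeq.code t] != 0) = link M (drop i t).
Proof.
set v := [@ i; _; _]; rewrite /plink.
have dE : peval (PComp pdrop [@ arg 3 0; arg 3 2]) v = CodeSeq.code (drop i t).
  by rewrite peval_comp /v !pargE peval_drop.
have hdE (s : prim 3) u : peval s v = CodeSeq.code u ->
    peval (PComp phead [@ s]) v = head 0 u.
  by move=> sE; rewrite peval_comp !pargE sE peval_head.
have tlE (s : prim 3) u : peval s v = CodeSeq.code u ->
    peval (PComp pbehead [@ s]) v = CodeSeq.code (behead u).
  by move=> sE; rewrite peval_comp !pargE sE peval_behead.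
rewrite peval_comp !pargE peval_if dE peval_const code_eq0 (peval_comp pif) !pargE.
rewrite peval_if (tlE _ _ dE) code_eq0 !(peval_comp pstep, peval_comp phalted) !pargE.
by rewrite (hdE _ _ (tlE _ _ dE)) (hdE _ _ dE) /v !pargE; case: (drop i t) => [|a [|b u]].
Qed.

(** Starting from a genuine configuration, each link shows that the next entry codes a successor of
    the current one; the last link gives halting. *)
Lemma run_of_links M c t :
  (forall i, i <= size t -> link M (drop i (code_config c :: t))) ->
  exists2 cs, t = map code_config cs & tm_run M c cs.
Proof.
elim: t c => [|d t IH] c links.
  by exists [::] => //; apply: peval_halted (links 0 isT).
have [c' d_c' step_c'] := peval_step (links 0 isT).
rewrite {d}d_c' in links *.
have [|cs -> /andP[path_cs halted_cs]] := IH c'; first by move=> i /(links i.+1).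
by exists (c' :: cs) => //; rewrite /tm_run /= step_c' path_cs.
Qed.

Lemma peval_init n (v : 'I_n -> nat) :
  peval (pinit n) v = code_config (tm_init (codom v)).
Proof.
rewrite /pinit; do 3 rewrite (peval_comp pcons) !pargE.
rewrite !peval_zero !peval_cons.
suff -> : peval (foldr (fun i r => PComp pstrokes [@ PProj i; r]) (PZero n)
    (enum 'I_n)) v = CodeSeq.code (tm_init (codom v)).2 by [].
rewrite codomE /=; elim: (enum 'I_n) => [|i s IH] //.
rewrite [foldr _ (PZero n) _]/= peval_comp !pargE IH; set u := foldr _ [::] (map v s).
(* One of the x + 1 strokes is split off, to match the base case of [pstrokes], which already writes
   a stroke. *)
rewrite -[RHS]/(CodeSeq.code (1 :: nseq (v i) 1 ++ 0 :: u)).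
elim: (v i) => [|k IHk]; rewrite /pstrokes !(peval_cons, peval_const, pevalE) //.
by rewrite -/pstrokes IHk.
Qed.

Lemma pT_run M n y (v : 'I_n -> nat) :
  peval (pT n) (vcons (code_machine M) (vcons y v)) != 0 ->
  exists2 cs, y = code_trace (tm_init (codom v) :: cs) &
    tm_run M (tm_init (codom v)) cs.
Proof.
rewrite /pT peval_comp !pargE peval_mul muln_eq0 negb_or => /andP[].
(* Every number codes a sequence, so y can be replaced by the code of its decoding, and the first
   factor of [pT] says that this sequence is nonempty. *)
rewrite peval_comp !pargE peval_true eqb0 negbK -[y]CodeSeq.decodeK.
rewrite code_eq0; case: (CodeSeq.decode y) => [//|a t] _.
rewrite peval_comp !pargE peval_mul muln_eq0 negb_or => /andP[].
rewrite (peval_comp peq) !pargE (peval_comp phead) !pargE peval_head peval_eq.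
rewrite (peval_comp (pinit n)) !pargE peval_init eqb0 negbK [head _ _]/= => /eqP ->.
rewrite (peval_comp (pall plink)) !pargE peval_all => /allP links.
have [|cs -> run_cs] := @run_of_links M (tm_init (codom v)) t; last by exists cs.
move=> i le_it; rewrite -peval_link; apply: links; rewrite mem_iota /=.
exact: leq_trans (size_code (_ :: _)).
Qed.

(** Determinism makes the next configurations equal, and a halted configuration has no successor, so
    neither run can stop before the other. *)
Lemma tm_run_functional M c cs cs' :
  deterministic M -> tm_run M c cs -> tm_run M c cs' -> cs = cs'.
Proof.
move=> det; rewrite /tm_run.
elim: cs c cs' => [|d cs IH] c [|d' cs'] //=.
- move=> /hasPn halted_c /andP[/andP[/hasP[i /halted_c /negP nA /andP[]]]].
  by move=> /nA.
- move=> /andP[/andP[/hasP[i iM /andP[iA _]] _] _] /hasPn /(_ i iM).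
  by rewrite iA.
move=> /andP[/andP[/hasP[i iM /andP[iA /eqP d_i]] p_cs] h_cs].
move=> /andP[/andP[/hasP[i' i'M /andP[i'A /eqP d_i']] p_cs'] h_cs'].
have e : d = d' by rewrite d_i d_i' (det _ _ _ iM i'M iA i'A).
rewrite -{d' d_i'}e in p_cs' h_cs' *.
by rewrite (IH d cs') ?p_cs ?p_cs'.
Qed.

Definition pones : prim 1 :=
  PComp (psum (PComp peq [@ pnth; pconst 2 1])) [@ arg 1 0; arg 1 0].

Lemma peval_ones s : peval pones [@ CodeSeq.code s] = count_mem 1 s.
Proof.
rewrite /pones peval_comp !pargE peval_sum.
transitivity (\sum_(i < CodeSeq.code s) (nth 0 s i == 1)).
  apply: eq_bigr => i _.
  by rewrite peval_comp !pargE peval_const peval_nth peval_eq.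
(* The bound is generalized to any k at least the length; positions past the end read 0 and are not
   counted as strokes. *)
elim: s (CodeSeq.code s) (size_code s) => [|a s IH] k.
  by move=> _; rewrite big1 // => i _; rewrite nth_nil.
by case: k => // k le_sk; rewrite big_ord_recl /= IH.
Qed.

(** The length of the trace is the number of its nonempty suffixes, and its predecessor is the index
    of the last configuration. *)
Definition poutput : prim 1 :=
  let size := PComp (psum (PComp ptrue [@ pdrop])) [@ arg 1 0; arg 1 0] in
  let c := PComp pnth [@ PComp ppred [@ size]; arg 1 0] in
  PComp padd [@ PComp pones [@ field 1 c]; PComp pones [@ field 2 c]].

Lemma peval_output c cs :
  peval poutput [@ code_trace (c :: cs)] = tm_output (last c cs).
Proof.
rewrite /poutput; set size_ := PComp (psum _) _; set c_ := PComp pnth _.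
set t := code_trace _.
have size_E : peval size_ [@ t] = (size cs).+1.
  rewrite /size_ peval_comp !pargE peval_sum.
  transitivity (\sum_(i < t) (i < (size cs).+1)).
    apply: eq_bigr => i _; rewrite peval_comp !pargE peval_drop peval_true.
    by rewrite code_eq0 -size_eq0 size_drop size_map subn_eq0 -ltnNge.
  rewrite sum_ltn; apply/minn_idPr.
  by have := size_code (map code_config (c :: cs)); rewrite size_map.
case E : (last c cs) => [[q l] r].
have c_E : peval c_ [@ t] = code_config (q, l, r).
  rewrite /c_ peval_comp !pargE (peval_comp ppred) !pargE size_E peval_pred.
  by rewrite peval_nth (nth_map c) // nth_last /= E.
rewrite peval_comp !pargE !(peval_comp pones) !pargE !(peval_field _ c_E).
by rewrite [nth _ _ 1]/= [nth _ _ 2]/= !peval_ones peval_add.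
Qed.

(** * Equational logic *)

(** The replacement rule acts on every occurrence of its variable. A variable above all those in the
    terms at hand marks just the place to be rewritten. *)
Lemma put_fresh x r t : tbound t <= x -> put x r t = t.
Proof.
move=> le_tx; rewrite -[RHS]tsubst_id; apply: tsubst_ext => i lt_it.
by rewrite ltn_eqF // (leq_trans lt_it).
Qed.

Lemma put_var x r : put x r (Var x) = r.
Proof. by rewrite /put /= eqxx. Qed.

Lemma eqprv_sym P t s : eqprv P (t, s) -> eqprv P (s, t).
Proof.
move=> Pts; have := @EqRepl P (tbound t) (Var (tbound t)) t t s.
by rewrite !put_var !put_fresh //; apply; [apply: EqRefl|].
Qed.

Lemma eqprv_trans P t s r : eqprv P (t, s) -> eqprv P (s, r) -> eqprv P (t, r).
Proof.
move=> Pts Psr; have := @EqRepl P (tbound t) t (Var (tbound t)) s r.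
by rewrite !put_var !put_fresh //; apply.
Qed.

Lemma leq_tbound_app n (f : funsym n) ts i : tbound (ts i) <= tbound (App f ts).
Proof. exact: (@leq_bigmax _ (fun i => tbound (ts i))). Qed.

Lemma eqprv_app P n (f : funsym n) ts ts' :
  (forall i, eqprv P (ts i, ts' i)) -> eqprv P (App f ts, App f ts').
Proof.
move=> Pts; pose mix k (u : 'I_n -> term) (i : 'I_n) :=
  if i < k then ts' i else if i == k :> nat then u i else ts i.
suff: eqprv P (App f ts, App f (mix n ts)).
  congr (eqprv P (_, App f _)).
  by apply: functional_extensionality => i; rewrite /mix ltn_ord.
pose x := maxn (tbound (App f ts)) (tbound (App f ts')).
have x_ts i : tbound (ts i) <= x.
  exact: leq_trans (leq_tbound_app f ts i) (leq_maxl _ _).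
have x_ts' i : tbound (ts' i) <= x.
  exact: leq_trans (leq_tbound_app f ts' i) (leq_maxr _ _).
have put_mix k u r : (fun i => put x r (mix k u i)) = mix k (fun i => put x r (u i)).
  apply: functional_extensionality => i; rewrite /mix.
  by case: ifP => _; [|case: ifP => _ //]; rewrite put_fresh.
suff mixP k : k <= n -> eqprv P (App f ts, App f (mix k ts)) by exact: mixP.
elim: k => [|k IH] lt_kn.
  suff -> : mix 0 ts = ts by apply: EqRefl.
  by apply: functional_extensionality => i; rewrite /mix ltn0; case: ifP.
pose j := Ordinal lt_kn.
have := @EqRepl P x (App f ts) (App f (mix k (fun=> Var x))) (ts j) (ts' j).
rewrite ![put x _ (App f ts)]put_fresh ?leq_maxl //.
rewrite -![put x _ (App f _)]/(App f (fun i => put x _ (mix k _ i))) !put_mix !put_var.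
have -> : mix k (fun=> ts j) = mix k ts.
  apply: functional_extensionality => i; rewrite /mix; case: ifP => // _.
  by case: eqP => // i_k; congr ts; apply: val_inj.
have -> : mix k (fun=> ts' j) = mix k.+1 ts.
  apply: functional_extensionality => i; rewrite /mix ltnS.
  case: (ltngtP i k) => [//|lt_ki|i_k]; last by congr ts'; apply: val_inj.
  by case: eqP => // i_k; rewrite i_k ltnNge leqnSn in lt_ki.
by apply; [apply/IH/ltnW | apply: Pts].
Qed.

Lemma eqprv_vcons P n a b (u w : 'I_n -> term) :
  eqprv P (a, b) -> (forall j, eqprv P (u j, w j)) ->
  forall i, eqprv P (vcons a u i, vcons b w i).
Proof.
move=> Pab Puw i; case: (unliftP ord0 i) => [j|] ->; last by rewrite !vcons0.
by rewrite !vconsS.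
Qed.

(** The rule substitutes for one variable at a time; since numerals are closed, successive
    substitutions amount to the simultaneous one. *)
Lemma eqprv_num_subst P E (e : nat -> nat) : P E ->
  eqprv P (tsubst (fun i => num (e i)) E.1, tsubst (fun i => num (e i)) E.2).
Proof.
move=> PE; pose s k i := if i < k then num (e i) else Var i.
have s_all t k : tbound t <= k -> tsubst (s k) t = tsubst (fun i => num (e i)) t.
  by move=> le_tk; apply: tsubst_ext => i lt_it; rewrite /s (leq_trans lt_it).
pose k := maxn (tbound E.1) (tbound E.2).
rewrite -!(s_all _ k) ?leq_maxl ?leq_maxr //; elim: k => [|k IH].
  have -> : s 0 = Var by exact: functional_extensionality.
  rewrite !tsubst_id.
  by case: (E) PE => ? ?; apply: EqMem.
have sS t : tsubst (s k.+1) t = put k (num (e k)) (tsubst (s k) t).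
  rewrite /put tsubst_comp; congr tsubst; apply: functional_extensionality => i.
  rewrite /s ltnS leq_eqVlt; case: eqP => [->|/eqP ne_ik] /=.
    by rewrite ltnn /= eqxx.
  by case: ifP => _; rewrite ?tsubst_num //= (negbTE ne_ik).
by rewrite !sS; apply: EqSubst.
Qed.

Definition ext_env n (v : 'I_n -> nat) (i : nat) : nat :=
  if insub i is Some j then v j else 0.

Lemma ext_env_ord n (v : 'I_n -> nat) (j : 'I_n) : ext_env v j = v j.
Proof. by rewrite /ext_env valK. Qed.

Lemma num_ext_env n (v : 'I_n -> nat) :
  (fun i : 'I_n => num (ext_env v i)) = (fun i => num (v i)).
Proof. by apply: functional_extensionality => i; rewrite ext_env_ord. Qed.

(** The defining equations at numerals are evaluated by induction on p, with an inner induction on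
    the recursion argument for [PRec]. *)
Lemma eqprv_peval P n (p : prim n) (v : 'I_n -> nat) : extends_PR P ->
  eqprv P (App (Pr p) (fun i => num (v i)), num (peval p v)).
Proof.
move=> PRP; have axiom m (q : prim m) E e : List.In E (defeqs q) ->
    eqprv P (tsubst (fun i => num (e i)) E.1, tsubst (fun i => num (e i)) E.2).
  by move=> /defeqs_PR/PRP; apply: eqprv_num_subst.
elim: {n} p v => [n||n i|n m h IHh g IHg|n g IHg h IHh] v.
- by have := axiom _ (PZero n) _ (ext_env v) (or_introl erefl); rewrite /= num_ext_env.
- have := axiom _ PSucc _ (ext_env v) (or_introl erefl); rewrite /= num_ext_env.
  by rewrite (ext_env_ord v ord0 : ext_env v 0 = _).
- have := axiom _ (PProj i) _ (ext_env v) (or_introl erefl); rewrite /= num_ext_env.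
  by rewrite ext_env_ord.
- have := axiom _ (PComp h g) _ (ext_env v) (or_introl erefl); rewrite /= num_ext_env.
  move=> /eqprv_trans; apply; apply: eqprv_trans (IHh _).
  exact: eqprv_app.
suff rec_num k w : eqprv P (App (Pr (PRec g h)) (vcons (num k) (fun j => num (w j))),
    num (peval (PRec g h) (vcons k w))).
  by rewrite [v]vcons_eta map_vcons.
elim: k => [|k IHk].
  rewrite peval_rec0; have := axiom _ (PRec g h) _ (scons 0 (ext_env w)) (or_introl erefl).
  by rewrite /= map_vcons /= num_ext_env => /eqprv_trans; apply.
rewrite peval_recS; set r := peval (PRec g h) _ in IHk *.
have := axiom _ (PRec g h) _ (scons k (ext_env w)) (or_intror (or_introl erefl)).
rewrite /= !map_vcons /= map_vcons /= num_ext_env => /eqprv_trans; apply.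
apply: eqprv_trans (IHh _); rewrite !map_vcons; apply: eqprv_app.
apply: eqprv_vcons; first exact: EqRefl.
by apply: eqprv_vcons => // j; apply: EqRefl.
Qed.

(** * The program for a provably recursive function *)

Definition fsym n : funsym n := Usr n 0.
Definition ksym n : funsym n.+2 := Usr n.+2 1.

(** The trace has index 0 and the inputs the indices 1 to n, as under the existential quantifier of
    [total_sentence], so that eliminating that quantifier yields this term equal to 1. *)
Definition trace_test (e n : nat) : term :=
  App (Pr (pT n)) (vcons (num e) (vcons (Var 0) (fun i : 'I_n => Var i.+1))).

Definition run_equation (e n : nat) : equation :=
  (App (ksym n) (vcons (trace_test e n) (vcons (Var 0) (fun i : 'I_n => Var i.+1))),
   App (fsym n) (fun i : 'I_n => Var i.+1)).

Definition output_equation (n : nat) : equation :=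
  (App (ksym n) (vcons (Succ (Var 0)) (vcons (Var 1) (fun i : 'I_n => Var i.+2))),
   App (Pr poutput) [@ Var 1]).

Definition search_program (e n : nat) (E : equation) : Prop :=
  [\/ PR E, E = run_equation e n | E = output_equation n].

Lemma search_program_PR e n : extends_PR (search_program e n).
Proof. by move=> E; constructor 1. Qed.

Lemma lang_fsym e n : lang (search_program e n) (fsym n).
Proof. by exists (run_equation e n); [constructor 2 | right; left]. Qed.

Lemma lang_ksym e n : lang (search_program e n) (ksym n).
Proof. by exists (run_equation e n); [constructor 2 | left; left]. Qed.

Lemma full_search_program e n : full (search_program e n).
Proof. by move=> m p _ E /defeqs_PR; apply: search_program_PR. Qed.

(* The junk value 0 is given to lists whose length is not [n]. *)
Definition seq_fun n (f : n.-tuple nat -> nat) (s : seq nat) : nat :=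
  if insub s is Some x then f x else 0.

(** Vectors are passed to lists so that one clause serves all arities: number 0 is read as f and
    every other number as k. *)
Definition search_structure n (f : n.-tuple nat -> nat) : structure :=
  fun m k v =>
    if k is 0 then seq_fun f (codom v)
    else match codom v with
         | z :: y :: x => if z != 0 then peval poutput [@ y] else seq_fun f x
         | _ => 0
         end.

Lemma codom_vcons n a (v : 'I_n -> nat) : codom (vcons a v) = a :: codom v.
Proof.
rewrite !codomE enum_ordSl /= vcons0 -map_comp; congr (_ :: _).
by apply: eq_map => j; rewrite /= vconsS.
Qed.

Lemma fval_ksym n (f : n.-tuple nat -> nat) z y x :
  fval (search_structure f) (ksym n) (vcons z (vcons y x)) =
  if z != 0 then peval poutput [@ y] else seq_fun f (codom x).
Proof. by rewrite /= !codom_vcons. Qed.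

Lemma seq_fun_codom n (f : n.-tuple nat -> nat) (x : 'I_n -> nat) :
  seq_fun f (codom x) = f [tuple x i | i < n].
Proof.
have -> : codom x = [tuple x i | i < n] by rewrite codomE.
by rewrite /seq_fun valK.
Qed.

Lemma output_of_trace M n (f : n.-tuple nat -> nat) y (x : 'I_n -> nat) :
  deterministic M -> tm_computes M f ->
  peval (pT n) (vcons (code_machine M) (vcons y x)) != 0 ->
  peval poutput [@ y] = f [tuple x i | i < n].
Proof.
move=> det Mf /pT_run[cs -> run_cs]; rewrite peval_output.
have [cs' run_cs' <-] := Mf [tuple x i | i < n].
have codom_x : tval [tuple x i | i < n] = codom x by rewrite codomE.
by rewrite codom_x in run_cs' *; rewrite (tm_run_functional det run_cs run_cs').
Qed.

Lemma teval_app I env n (g : funsym n) ts :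
  teval I env (App g ts) = fval I g (fun i => teval I env (ts i)).
Proof. by []. Qed.

Lemma search_program_valid M n (f : n.-tuple nat -> nat) E :
  deterministic M -> tm_computes M f ->
  search_program (code_machine M) n E -> valid (search_structure f) E.
Proof.
move=> det Mf [/PR_valid //|->|->] env; set I := search_structure f.
  rewrite -[LHS]/(teval I env (App (ksym n)
    (vcons (trace_test (code_machine M) n) (vcons (Var 0) (fun i : 'I_n => Var i.+1))))).
  rewrite teval_app !map_vcons fval_ksym teval_app !map_vcons teval_num.
  (* If the test fails, k returns f(x) by definition; if it succeeds, y is the trace of the unique
     run and its output is f(x). *)
  case: ifP => // T1; rewrite (output_of_trace (y := env 0) det Mf T1).
  by rewrite -seq_fun_codom.
rewrite -[LHS]/(teval I env (App (ksym n)
  (vcons (Succ (Var 0)) (vcons (Var 1) (fun i : 'I_n => Var i.+2))))).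
rewrite -[RHS]/(teval I env (App (Pr poutput) [@ Var 1])).
by rewrite !teval_app !map_vcons map_vnil fval_ksym.
Qed.

Lemma sat_of_iter_all I k A :
  (forall env, sat I env (iter k All A)) -> forall env, sat I env A.
Proof.
elim: k A => // k IH A; rewrite iterSr => /IH sA env.
have := sA (fun i => env i.+1) (env 0).
suff -> : scons (env 0) (fun i => env i.+1) = env by [].
by apply: functional_extensionality => -[].
Qed.

Lemma nd_all_iter_closed L Ax B k A :
  nd L Ax B [::] A -> nd L Ax B [::] (iter k All A).
Proof. by move=> dA; elim: k => //= k IH; apply: NdAllI. Qed.

Lemma search_program_total e n :
  provable PR (total_sentence (@formT n (num e))) ->
  provable_basic (search_program e n)
    (total_sentence (fun x y => Eqn (App (fsym n) x) y)).
Proof.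
set P := search_program e n; have PRP : extends_PR P := @search_program_PR e n.
move=> /(nd_basic_of_PR PRP (fun C (in0 : List.In C [::]) => match in0 with end)).
set x_ := fun i : 'I_n => Var i.+1.
have xL i : tin (lang P) (x_ i) by exact: tin_var.
have var_tot G i : basic_nd P G (tot (Var i)) by apply: nd_basic_tot.
have TL : tin (lang P) (trace_test e n).
  apply: tin_Pr => //; apply: forall_vcons; first exact: tin_num.
  exact: forall_vcons.
have fL : tin (lang P) (App (fsym n) x_) by apply: tin_app => //; apply: lang_fsym.
have kL t : tin (lang P) t -> tin (lang P) (App (ksym n) (vcons t (vcons (Var 0) x_))).
  move=> tL; apply: tin_app; first exact: lang_ksym.
  by do 2![apply: forall_vcons => //].
rewrite /provable_basic /total_sentence; set A := Ex _ => dA; apply: nd_all_iter_closed.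
(* The quantifiers are instantiated at their own variables, which leaves the body unchanged and
   makes x free. *)
have {}dA : basic_nd P [::] A.
  have AL : fin (lang P) A by split=> //; apply: tin_num.
  have := nd_iter_all_tot AL (fun i _ => @tin_var _ i) (fun i _ => var_tot _ i) dA.
  congr (nd _ _ _ _ _); rewrite /A /= !map_vcons !tsubst_num /=.
  congr (Ex (Eqn (App _ (vcons _ (vcons _ _))) _)).
  by apply: functional_extensionality => i; rewrite /= ltn_ord.
apply: NdExE dA _; set H := _ :: _.
rewrite -[Ex _]/(tot (App (fsym n) (@vars n))) [shift _]fsubst_tot /=.
have run : basic_nd P H
    (Eqn (App (ksym n) (vcons (trace_test e n) (vcons (Var 0) x_))) (App (fsym n) x_)).
  have := @nd_equation_tot P H (run_equation e n) Var.
  by rewrite !tsubst_id; apply=> //; constructor 2.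
have out : basic_nd P H
    (Eqn (App (ksym n) (vcons (Succ Zero) (vcons (Var 0) x_)))
         (App (Pr poutput) [@ Var 0])).
  (* The variable z goes to 0, turning S(z) into 1, and the other variables drop by one to the
     indices of the current context. *)
  have := @nd_equation_tot P H (output_equation n)
    (fun i => if i is j.+1 then Var j else Zero).
  rewrite /= !map_vcons map_vnil; apply; first by constructor 3.
    by case.
  by move=> [|i] _ //; apply: nd_basic_tot.
have {}run : basic_nd P H
    (Eqn (App (ksym n) (vcons (Succ Zero) (vcons (Var 0) x_))) (App (fsym n) x_)).
  have E t : Eqn (App (ksym n) (vcons t (vcons (Var 0) x_))) (App (fsym n) x_) =
      inst t (Eqn (App (ksym n) (vcons (Var 0) (vcons (Var 1) (fun i : 'I_n => Var i.+2))))
                  (App (fsym n) (fun i : 'I_n => Var i.+2))).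
    by rewrite /inst /= !map_vcons.
  rewrite E; apply: (@NdSubst _ _ _ _ _ (trace_test e n)); first by rewrite -E.
  (* The hypothesis T(e,x,y) = 1, from the eliminated existential, rewrites the first argument of
     k. *)
  by apply: NdHyp; left.
have kL1 := kL (Succ Zero) (tin_succ (@tin_zero _)).
apply: nd_eq_tot (nd_sym run kL1) fL _; apply: nd_eq_tot out kL1 _.
apply: nd_app_tot => //; first exact: nd_prim_tot.
  by apply: forall_vcons => // -[].
by apply: (forall_vcons (Q := fun t => basic_nd P H (tot t))) => // -[].
Qed.

Lemma search_program_computes M n (f : n.-tuple nat -> nat) :
  deterministic M -> tm_computes M f ->
  provable PR (total_sentence (@formT n (num (code_machine M)))) ->
  program_computes (search_program (code_machine M) n) (fsym n) f.
Proof.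
move=> det Mf proof x m; set e := code_machine M; set P := search_program _ _.
have PRP : extends_PR P := @search_program_PR e n.
have tuple_x : [tuple tnth x i | i < n] = x.
  by apply: eq_from_tnth => i; rewrite tnth_mktuple.
(* A derivable equation holds in the model, where the symbol for f denotes f; this excludes wrong
   values. *)
split=> [/(eqprv_sound (fun E => search_program_valid det Mf))/(_ (fun=> 0))|->].
  rewrite /= teval_num => <-; rewrite -[in RHS]tuple_x -seq_fun_codom.
  by congr (seq_fun f (codom _)); apply: functional_extensionality => i; rewrite teval_num.
(* For the converse, the truth of the totality sentence at the inputs x supplies a trace y. *)
have [y sat_y] := sat_of_iter_all
  (provable_sound (@PR_valid (search_structure f)) proof) (ext_env (tnth x)).
have T1 : peval (pT n) (vcons e (vcons y (tnth x))) = 1.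
  have : teval _ _ (trace_test e n) = teval _ _ (num 1) := sat_y.
  rewrite teval_app !map_vcons !teval_num => <-; congr (peval _ (vcons _ (vcons _ _))).
  by apply: functional_extensionality => i; rewrite -ext_env_ord.
set xs := fun i : 'I_n => num (tnth x i).
pose T_ := App (Pr (pT n)) (vcons (num e) (vcons (num y) xs)).
pose k_ t := App (ksym n) (vcons t (vcons (num y) xs)).
have run : eqprv P (k_ T_, App (fsym n) xs).
  have := @eqprv_num_subst P _ (scons y (ext_env (tnth x)))
    (Or32 _ _ (erefl (run_equation e n))).
  by rewrite /= !map_vcons /= !map_vcons tsubst_num /= num_ext_env.
have out : eqprv P (k_ (num 1), num (peval poutput [@ y])).
  (* With z = 0 the first argument S(z) is the numeral 1, the value of the successful test. *)
  have := @eqprv_num_subst P _ (scons 0 (scons y (ext_env (tnth x))))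
    (Or33 _ _ (erefl (output_equation n))).
  rewrite [tsubst _ _.1]/= [tsubst _ _.2]/= !map_vcons map_vnil /= num_ext_env.
  move=> /eqprv_trans; apply; have := eqprv_peval poutput [@ y] PRP.
  by rewrite map_vcons map_vnil.
have T_e : eqprv P (T_, num 1).
  have := eqprv_peval (pT n) (vcons e (vcons y (tnth x))) PRP.
  by rewrite T1 !map_vcons.
rewrite -[in f _]tuple_x -(output_of_trace (y := y) det Mf) ?T1 //.
(* The chain is f(x) = k(T,y,x) = k(1,y,x) = U(y), with T evaluated to 1 inside k. *)
apply: eqprv_trans out; apply: eqprv_trans (eqprv_sym run) _.
by apply/eqprv_app/eqprv_vcons => // j; apply: EqRefl.
Qed.

Theorem theorem4 (n : nat) (f : n.-tuple nat -> nat) :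
  provably_recursive f ->
  exists (P : equation -> Prop) (g : funsym n),
    [/\ lang P g, strongly_coherent P, full P, program_computes P g f
      & provable_basic P (total_sentence (fun x y => Eqn (App g x) y))].
Proof.
move=> [M [det Mf proof]]; exists (search_program (code_machine M) n), (fsym n); split.
- exact: lang_fsym.
- move=> /(provable_sound (fun E => search_program_valid det Mf)).
  by move=> /(_ (fun=> 0)).
- exact: full_search_program.
- exact: search_program_computes.
- exact: search_program_total.
Qed.
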